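(* Let $(X,T)$ be a topological dynamical system satisfying the specification property, let $\mathcal{F}=\{f_n\}_{n\ge1}$ and $\Phi=\{\varphi_n\}_{n\ge1}$ be asymptotically additive potentials on $X$, and let $\mathcal{G}=\{g_n\}_{n\ge1}$ and $\Psi=\{\psi_n\}_{n\ge1}$ be asymptotically additive potentials on $X$ for which there is a constant $\sigma>0$ with $\frac1n g_n(x)\ge\sigma$ and $\frac1n\psi_n(x)\ge\sigma$ for all $n\in\mathbb{N}$ and $x\in X$. Then for any $\alpha\in\mathbb{R}$ with $E_{\Phi,\Psi}(\alpha)\ne\emptyset$, $$\sup_{x\in E_{\Phi,\Psi}(\alpha)}\limsup_{n\to\infty}\frac{f_n(x)}{g_n(x)}=\sup\Big\{\frac{\mathcal{F}_*(\mu)}{\mathcal{G}_*(\mu)}:\mu\in\mathcal{M}_T,\ \frac{\Phi_*(\mu)}{\Psi_*(\mu)}=\alpha\Big\}=\sup\Big\{\frac{\mathcal{F}_*(\mu)}{\mathcal{G}_*(\mu)}:\mu\in\bigcup_{x\in E_{\Phi,\Psi}(\alpha)}\mathcal{V}(x)\Big\}.$$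
   Context: $X$ is a compact metric space with metric $d$ and $T:X\to X$ is continuous. $\mathcal{M}_T$ denotes the set of $T$-invariant Borel probability measures on $X$. For $f\in C(X)$, $S_nf=\sum_{i=0}^{n-1}f\circ T^i$. A sequence $\mathcal{F}=\{f_n\}_{n\ge1}\subset C(X)$ is an asymptotically additive potential (AAP) if for every $\xi>0$ there is $f_\xi\in C(X)$ with $\limsup_{n\to\infty}\frac1n\|f_n-S_nf_\xi\|_\infty<\xi$; for $\mu\in\mathcal{M}_T$, $\mathcal{F}_*(\mu)=\lim_{n\to\infty}\frac1n\int f_n\,d\mu$ (this limit exists). $E_{\Phi,\Psi}(\alpha)=\{x\in X:\lim_{n\to\infty}\varphi_n(x)/\psi_n(x)=\alpha\}$. For $x\in X$, $\mathcal{V}(x)$ is the set of weak$^*$ limit points of $\delta_{x,n}=\frac1n\sum_{i=0}^{n-1}\delta_{T^ix}$. $(X,T)$ has the specification property if for every $\epsilon>0$ there is an integer $m(\epsilon)$ such that for any finite collection of intervals $[a_j,b_j]\subset\mathbb{N}$, $j=1,\dots,k$, with $a_{j+1}-b_j\ge m(\epsilon)$ for $j=1,\dots,k-1$, and any $x_1,\dots,x_k\in X$, there is $x\in X$ with $d(T^{p+a_j}x,T^px_j)<\epsilon$ for all $p=0,1,\dots,b_j-a_j$ and all $j$. *)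

(* Defs.v *)
From HB Require Import structures.
From mathcomp Require Import all_boot all_order all_algebra.
From mathcomp Require Import all_classical all_reals all_analysis.
Set Implicit Arguments. Unset Strict Implicit. Unset Printing Implicit Defensive.
Import Order.TTheory GRing.Theory Num.Theory.
Import numFieldNormedType.Exports.
Local Open Scope classical_set_scope.
Local Open Scope ring_scope.

(* A (nonempty) metric space: metric structure + a distinguished point
   (the point is only needed by the library to build the Borel sigma-algebra). *)
#[short(type="pointedMetricType")]
HB.structure Definition PointedMetric (R : numDomainType) :=
  { M of Pointed M & Metric R M }.

Section Dyn.
Context {R : realType} {X : pointedMetricType R}.
Local Notation BX := (g_sigma_algebraType (@open X)).

Definition birkhoff (T : X -> X) (h : X -> R) (n : nat) (x : X) : R :=
  \sum_(i < n) h (iter i T x).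

(* Asymptotically additive potential {f_n}_{n>=1} (f 0 is irrelevant):
   each f_n (n >= 1) continuous, and for every xi > 0 there is a continuous
   h with limsup_n (1/n) ||f_n - S_n h||_oo < xi, written out as:
   there are eta < xi and N with ||f_n - S_n h||_oo <= n * eta for n >= N. *)
Definition AAP (T : X -> X) (f : nat -> X -> R) : Prop :=
  (forall n, (0 < n)%N -> continuous (f n)) /\
  forall xi : R, 0 < xi -> exists h : X -> R, continuous h /\
    exists eta : R, eta < xi /\ exists N : nat, forall n, (N <= n)%N ->
      forall x, `| f n x - birkhoff T h n x | <= n%:R * eta.

Definition specification (T : X -> X) : Prop :=
  forall eps : R, 0 < eps -> exists m : nat,
    forall (k : nat) (a b : nat -> nat) (xs : nat -> X),
      (forall j, (j < k)%N -> (a j <= b j)%N) ->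
      (forall j, (j.+1 < k)%N -> (b j + m <= a j.+1)%N) ->
      exists x : X, forall j, (j < k)%N -> forall p, (p <= b j - a j)%N ->
        mdist (iter (p + a j) T x) (iter p T (xs j)) < eps.

Definition Tinvariant (T : X -> X) (mu : probability BX R) : Prop :=
  forall A : set BX, measurable A -> mu (T @^-1` A) = mu A.

Definition rint (mu : probability BX R) (h : X -> R) : R :=
  fine (\int[mu]_x (h x)%:E)%E.

Definition pstar (f : nat -> X -> R) (mu : probability BX R) : R :=
  limn (fun n => (n%:R)^-1 * rint mu (f n)).

Definition levelset (phi psi : nat -> X -> R) (alpha : R) : set X :=
  [set x | (fun n => phi n x / psi n x) @ \oo --> alpha].

(* V(x): weak* limit points of the empirical measures delta_{x,n}, i.e.
   cluster points in the weak* topology: every basic weak* neighbourhood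
   (finitely many continuous test functions, tolerance e) is visited by
   delta_{x,n} for arbitrarily large n.  Note int h d(delta_{x,n}) =
   (1/n) S_n h (x). *)
Definition Vlim (T : X -> X) (x : X) : set (probability BX R) :=
  [set mu | forall (hs : seq (X -> R)) (e : R),
      (forall h, h \in hs -> continuous h) -> 0 < e ->
      forall N : nat, exists n : nat, (N <= n)%N /\ (0 < n)%N /\
        forall h, h \in hs ->
          `| (n%:R)^-1 * birkhoff T h n x - rint mu h | < e].

End Dyn.

Definition borelX {R : realType} (X : pointedMetricType R) :=
  g_sigma_algebraType (@open X).

(* Main.v *)
(** Every cluster measure of the empirical measures of a point of the level set
    is invariant with ratio [alpha], which compares the last two suprema.

    Given [x] in the level set and [c < limsup f_n(x)/g_n(x)], the limit of the
    orbit averages of [x] along an ultrafilter containing the times where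
    [f_n(x)/g_n(x) > c] is a positive normalized functional.  It is represented
    by a Borel probability (inner regularity on open sets, then Caratheodory),
    which lies in [Vlim T x] and has ratio at least [c].

    Conversely every invariant [mu] has a generic point [x], for which
    [f_n(x)/g_n(x)] converges to the ratio of [mu].  No ergodic decomposition
    is needed: since the integral of a Birkhoff sum of length [n] is [n] times
    that of the function, it is enough to sample finitely many initial points
    whose Birkhoff sums average to the integral.  Choosing them greedily keeps
    the squared norm of the vector of centred sums linear in the number of
    points.  Specification concatenates the segments at finer and finer scales,
    and [x] is a cluster point of the resulting orbits. *)
Require Import Defs.
From HB Require Import structures.
From mathcomp Require Import all_boot all_order all_algebra.
From mathcomp Require Import all_classical all_reals all_analysis.
From mathcomp Require Import measurable_realfun zify ring lra.
Import Order.TTheory GRing.Theory Num.Theory.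
Import numFieldNormedType.Exports.
Local Open Scope classical_set_scope.
Local Open Scope ring_scope.
Set Implicit Arguments.
Unset Strict Implicit.
Unset Printing Implicit Defensive.

(** * The measure dominating a content on closed sets *)

Section outer_measure_of_content.
Context {R : realType} {X : pointedMetricType R}.
Hypothesis compactX : compact [set: X].
Variable l : set X -> R.
Hypothesis l0 : l set0 = 0.
Hypothesis lT : l setT = 1.
Hypothesis le_l : forall A B, A `<=` B -> l A <= l B.
Hypothesis lU : forall A B, l (A `|` B) <= l A + l B.
Hypothesis lUd : forall A B, A `&` B = set0 -> l (A `|` B) = l A + l B.

Local Open Scope ereal_scope.

(** [l] is only finitely additive and carries no continuity. Passing to closed subsets of open sets,
    then to open supersets, lets compactness supply the countable subadditivity. *)
Definition inner_open (U : set X) : \bar R :=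
  ereal_sup [set (l K)%:E | K in [set K | closed K /\ K `<=` U]].

Definition outer_of_content (A : set X) : \bar R :=
  ereal_inf [set inner_open U | U in [set U | open U /\ A `<=` U]].

Lemma inner_open_ge (U K : set X) : closed K -> K `<=` U ->
  (l K)%:E <= inner_open U.
Proof. by move=> cK KU; apply: ereal_sup_ubound; exists K. Qed.

Lemma inner_open_ge0 (U : set X) : 0 <= inner_open U.
Proof. by rewrite -[leLHS]/(0%R%:E) -l0; apply: inner_open_ge; [exact: closed0|exact: sub0set]. Qed.

Lemma inner_open_le (U : set X) : inner_open U <= (l U)%:E.
Proof.
by apply: ge_ereal_sup => _ [K [_ KU] <-]; rewrite lee_fin le_l.
Qed.

Lemma inner_open_fin (U : set X) : inner_open U \is a fin_num.
Proof.
by rewrite ge0_fin_numE ?inner_open_ge0// (le_lt_trans (inner_open_le U))// ltry.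
Qed.

(** A point of the ball lying outside [U] stays within distance [d] of all nearby centres, so the
    complement is open. For positive [d] these sets are closed pieces inside [U]. *)
Lemma closed_ball_sub (U : set X) (d : R) : closed [set x : X | ball x d `<=` U].
Proof.
rewrite -[X in closed X]setCK; apply: open_closedC.
rewrite openE => x /= /existsNP[y] /not_implyP[]; rewrite ballEmdist/= => xy Uy.
have e0 : (0 < d - mdist x y)%R by rewrite subr_gt0.
apply/nbhs_ballP; exists (d - mdist x y)%R => //= z; rewrite ballEmdist/= => xz zU.
apply: Uy; apply: zU; rewrite ballEmdist/=.
rewrite (le_lt_trans (metric_triangle z x y))// metric_sym.
by rewrite -ltrBrDr.
Qed.

(** A single [N] bounds both the indices and the inverse radius, so compactness in its near-covering
    form applies to one filter. *)
Lemma lebesgue_number (K : set X) (U : nat -> set X) : closed K ->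
  (forall n, open (U n)) -> K `<=` \bigcup_n U n ->
  exists N : nat, forall x, K x ->
    exists2 n, (n < N)%N & ball x N.+1%:R^-1 `<=` U n.
Proof.
move=> cK oU KU.
have /compact_near_coveringP cptK : compact K.
  exact: subclosed_compact compactX _.
have := cptK nat \oo (fun N x => exists2 n, (n < N)%N &
  ball x N.+1%:R^-1 `<=` U n) _.
case=> [x Kx|N _ NK]; last first.
  by exists N => x Kx; exact: (NK N (leqnn _) x Kx).
have [n _ Unx] := KU _ Kx.
have := oU n; rewrite openE => /(_ x Unx)/nbhs_ballP[e /= e0 eU].
have e20 : (0 < e / 2)%R by rewrite divr_gt0.
near=> y N => /=; exists n.
  by near: N; exists n.+1.
move=> z yz; apply: eU.
rewrite (splitr e); apply: (@ball_triangle _ _ y).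
  by near: y; apply: nbhsx_ballx.
apply: le_ball yz; apply: ltW; near: N.
exact: (near_infty_natSinv_lt (PosNum e20)).
Unshelve. all: by end_near.
Qed.

(** The Lebesgue number covers a closed [K] by finitely many closed sets [C n] with [C n] inside
    [U n]. Finite subadditivity of [l] then suffices. *)
Lemma inner_open_sigma_subadditive (U : nat -> set X) :
  (forall n, open (U n)) ->
  inner_open (\bigcup_n U n) <= \sum_(i <oo) inner_open (U i).
Proof.
move=> oU; apply: ge_ereal_sup => _ [K [cK KU] <-].
have [N NK] := lebesgue_number cK oU KU.
pose C n := [set x : X | ball x N.+1%:R^-1 `<=` U n].
have KC : K `<=` \big[setU/set0]_(n < N) C n.
  move=> x /NK[n nN nU]; rewrite -bigcup_mkord; exists n => //.
have : (l K <= \sum_(n < N) l (C n))%R.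
  apply: le_trans (le_l KC) _.
  elim/big_ind2 : _ => //; first by rewrite l0.
  by move=> A a B b Aa Bb; apply: le_trans (lU _ _) _; exact: lerD.
rewrite -lee_fin => /le_trans; apply.
apply: (@le_trans _ _ (\sum_(0 <= n < N) inner_open (U n))); last first.
  by apply: nneseries_lim_ge => n _ _; exact: inner_open_ge0.
rewrite big_mkord -sumEFin; apply: lee_sum => n _; apply: inner_open_ge.
  exact: closed_ball_sub.
by move=> x; apply; exact: ballxx.
Qed.

Lemma outer_of_content_le (A U : set X) : open U -> A `<=` U ->
  outer_of_content A <= inner_open U.
Proof. by move=> oU AU; apply: ereal_inf_lbound; exists U. Qed.

Lemma outer_of_content_ge0 (A : set X) : 0 <= outer_of_content A.
Proof.
by apply: le_ereal_inf_tmp => _ [U _ <-]; exact: inner_open_ge0.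
Qed.

Lemma outer_of_content_fin (A : set X) : outer_of_content A \is a fin_num.
Proof.
rewrite ge0_fin_numE ?outer_of_content_ge0//.
rewrite (le_lt_trans (@outer_of_content_le A setT openT _))//.
by rewrite -ge0_fin_numE ?inner_open_ge0 ?inner_open_fin.
Qed.

Lemma outer_of_content_approx (A : set X) (e : R) : (0 < e)%R ->
  exists U, [/\ open U, A `<=` U & inner_open U <= outer_of_content A + e%:E].
Proof.
move=> e0; have [_ [U [oU AU] <-] Ue] :=
  lb_ereal_inf_adherent e0 (outer_of_content_fin A).
by exists U; split => //; exact: ltW.
Qed.

Lemma outer_of_content0 : outer_of_content set0 = 0.
Proof.
apply/eqP; rewrite eq_le outer_of_content_ge0 andbT.
apply: le_trans (@outer_of_content_le set0 set0 open0 _) _ => //.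
by rewrite -[leRHS]/(0%R%:E) -l0 inner_open_le.
Qed.

Lemma outer_of_content_sigma (A : set X) (F : nat -> set X) :
  subset_sigma_subadditive outer_of_content A F.
Proof.
move=> AF; apply/lee_addgt0Pr => e e0.
have e2 n : (0 < e / (2 ^ n.+1)%:R)%R by rewrite divr_gt0// ltr0n expn_gt0.
have /choice[U UP] n := outer_of_content_approx (F n) (e2 n).
apply: le_trans (epsilon_trick (fun=> true) _ (ltW e0)); last first.
  by move=> n; exact: outer_of_content_ge0.
apply: (@le_trans _ _ (\sum_(i <oo) inner_open (U i))); last first.
  apply: lee_nneseries => [n _ _|n _]; first exact: inner_open_ge0.
  by have [] := UP n.
apply: le_trans (inner_open_sigma_subadditive _); last first.
  by move=> n; have [] := UP n.
apply: outer_of_content_le.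
  by apply: bigcup_open => n _; have [] := UP n.
apply: subset_trans AF _; apply: subset_bigcup => n _.
by have [] := UP n.
Qed.

HB.instance Definition _ := isSubsetOuterMeasure.Build R X outer_of_content
  outer_of_content0 outer_of_content_ge0 outer_of_content_sigma.

(** Take [V] open around [A], a closed [K] nearly filling the intersection of [V] and [U], and a
    closed [K'] nearly filling [V] minus [K]. The latter set is open and contains [A] minus [U].
    Since [K] and [K'] are disjoint inside [V], their contents add up to at most that of [V]. *)
Lemma outer_of_content_open (U : set X) : open U ->
  outer_of_content.-caratheodory U.
Proof.
move=> oU; apply: le_caratheodory_measurable => A.
rewrite -[leLHS]/(outer_of_content (A `&` U) + outer_of_content (A `&` ~` U)).
rewrite -[leRHS]/(outer_of_content A).
apply/lee_addgt0Pr => /= e e0.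
have e3 : (0 < e / 3)%R by rewrite divr_gt0.
have [V [oV AV Ve]] := outer_of_content_approx A e3.
have [_ [K [cK KVU] <-] Ke] :=
  ub_ereal_sup_adherent e3 (inner_open_fin (V `&` U)).
have [_ [K' [cK' KV'] <-] Ke'] :=
  ub_ereal_sup_adherent e3 (inner_open_fin (V `\` K)).
have KK' : K `&` K' = set0.
  by rewrite -subset0 => x [Kx /KV'[]].
have h1 : (l K)%:E + (l K')%:E <= inner_open V.
  rewrite -EFinD -lUd//; apply: inner_open_ge; first exact: closedU.
  by move=> x [/KVU[]//|/KV'[]].
have h2 : outer_of_content (A `&` U) <= inner_open (V `&` U).
  by apply: outer_of_content_le; [exact: openI|exact: setSI].
have h3 : outer_of_content (A `&` ~` U) <= inner_open (V `\` K).
  apply: outer_of_content_le; first by rewrite setDE; apply: openI => //; exact: closed_openC.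
  by move=> x [/AV Vx Ux]; split => // /KVU[].
move: Ke Ke' Ve h1 h2 h3; rewrite -!/(inner_open _).
rewrite -(fineK (outer_of_content_fin A)).
rewrite -(fineK (outer_of_content_fin (A `&` U))).
rewrite -(fineK (outer_of_content_fin (A `&` ~` U))).
rewrite -(fineK (inner_open_fin V)).
rewrite -(fineK (inner_open_fin (V `&` U))).
rewrite -(fineK (inner_open_fin (V `\` K))).
rewrite -!EFinD !lte_fin !lee_fin.
lra.
Qed.

Lemma outer_of_content_borel (A : set (borelX X)) : measurable A ->
  outer_of_content.-caratheodory A.
Proof.
suff: <<s (@open X) >> `<=` [set B | outer_of_content.-caratheodory B] by exact.
apply: smallest_sub.
- split => [|B cB|F cF].
  + exact: caratheodory_measurable_set0.
  + by rewrite setTD; exact: caratheodory_measurable_setC.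
  + exact: caratheodory_measurable_bigcup.
- by move=> U; exact: outer_of_content_open.
Qed.

Let mu (A : set (borelX X)) : \bar R := outer_of_content A.

Let mu0 : mu set0 = 0. Proof. exact: outer_of_content0. Qed.
Let mu_ge0 A : 0 <= mu A. Proof. exact: outer_of_content_ge0. Qed.

Let mu_sigma_additive : semi_sigma_additive mu.
Proof.
move=> F mF tF mUF.
apply: (@caratheodory_measure_sigma_additive R X outer_of_content F) => //.
  by move=> n; exact: outer_of_content_borel (mF n).
exact: outer_of_content_borel mUF.
Qed.

HB.instance Definition _ := isMeasure.Build _ _ _ mu mu0 mu_ge0 mu_sigma_additive.

Let outer_of_content_ge (C : set X) : closed C -> (l C)%:E <= outer_of_content C.
Proof.
move=> cC; apply: le_ereal_inf_tmp => _ [U [oU CU] <-].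
exact: inner_open_ge.
Qed.

Let muT : mu setT = 1.
Proof.
apply/eqP; rewrite eq_le; apply/andP; split.
  apply: le_trans (@outer_of_content_le setT setT openT _) _ => //.
  by rewrite (le_trans (inner_open_le _))// lT.
by rewrite -lT; apply: outer_of_content_ge; exact: closedT.
Qed.

HB.instance Definition _ := Measure_isProbability.Build _ _ _ mu muT.

(** The one-sided bound is enough for Riesz representation: both sides have total mass one, so
    testing [h] and its opposite yields equality. *)
Lemma content_dominated : exists P : probability (borelX X) R,
  forall C : set X, closed C -> (l C)%:E <= P C.
Proof. by exists mu => C; exact: outer_of_content_ge. Qed.

End outer_measure_of_content.

(** * Integration of bounded Borel functions *)

Section continuous_integral.
Context {R : realType} {X : pointedMetricType R}.
Hypothesis compactX : compact [set: X].
Implicit Types (h : X -> R) (mu : probability (borelX X) R).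

(** Functionals are taken on all bounded functions, measurable or not, so that they can be evaluated
    on indicators. *)
Definition bdd (h : X -> R) := exists M : R, forall x, `|h x| <= M.

Lemma continuous_bdd h : continuous h -> bdd h.
Proof.
move=> ch.
have /compact_bounded[M [_ Mh]] : compact (h @` setT).
  by apply: continuous_compact => //; exact: continuous_subspaceT.
exists (M + 1) => x; apply: (Mh (M + 1)); first by rewrite ltrDl.
by exists x.
Qed.

Lemma bdd_add (f g : X -> R) : bdd f -> bdd g -> bdd (fun x => f x + g x).
Proof.
move=> [M Mf] [N Ng]; exists (M + N) => x.
by apply: le_trans (ler_normD _ _) _; exact: lerD.
Qed.

Lemma bdd_cst (c : R) : bdd (fun=> c).
Proof. by exists `|c|. Qed.

Lemma bdd_opp (f : X -> R) : bdd f -> bdd (fun x => - f x).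
Proof. by move=> [M Mf]; exists M => x; rewrite normrN. Qed.

Lemma borel_closed (C : set X) : closed C -> measurable (C : set (borelX X)).
Proof.
move=> cC; rewrite -[C]setCK; apply: measurableC.
by apply: sub_sigma_algebra; exact: closed_openC.
Qed.

Lemma continuous_measurable h : continuous h ->
  measurable_fun [set: borelX X] (h : borelX X -> R).
Proof.
move=> ch; apply: (measurability _ (RGenOpens.measurableE R)).
move=> _ [_ [a [b ->]] <-]; rewrite setTI; apply: sub_sigma_algebra.
by apply: open_comp => [x _|]; [exact: ch|exact: interval_open].
Qed.

Definition bmeas (h : X -> R) := bdd h /\ measurable_fun [set: borelX X] (h : borelX X -> R).

Lemma bmeas_continuous h : continuous h -> bmeas h.
Proof. by move=> ch; split; [exact: continuous_bdd|exact: continuous_measurable]. Qed.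

Lemma bmeasD (f g : X -> R) : bmeas f -> bmeas g -> bmeas (fun x => f x + g x).
Proof.
by move=> [bf mf] [bg mg]; split; [exact: bdd_add|exact: measurable_funD].
Qed.

Lemma bmeas_cst (c : R) : bmeas (fun=> c).
Proof. by split; [exact: bdd_cst|exact: measurable_cst]. Qed.

Lemma bmeasM (f g : X -> R) : bmeas f -> bmeas g -> bmeas (fun x => f x * g x).
Proof.
move=> [[M Mf] mf] [[N Ng] mg]; split; last exact: measurable_funM.
by exists (M * N) => x; rewrite normrM; exact: ler_pM.
Qed.

Lemma bmeas_sum (n : nat) (F : nat -> X -> R) :
  (forall i, (i < n)%N -> bmeas (F i)) ->
  bmeas (fun x => \sum_(i < n) F i x).
Proof.
elim: n => [|n IH] cF.
  by under eq_fun do rewrite big_ord0; exact: bmeas_cst.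
under eq_fun do rewrite big_ord_recr/=.
by apply: bmeasD; [apply: IH => i ni; apply: cF; exact: ltnW|exact: cF].
Qed.

Lemma integrable_bmeas mu h : bmeas h ->
  mu.-integrable [set: borelX X] (EFin \o h).
Proof.
move=> [[M Mh] mh]; apply: measurable_bounded_integrable => //.
  exact: le_lt_trans (probability_le1 mu measurableT) (ltry 1).
by exists M; split; [exact: num_real|move=> x /ltW Mx y _; exact: le_trans (Mh y) Mx].
Qed.

Lemma rintD mu (f g : X -> R) : bmeas f -> bmeas g ->
  rint mu (fun x => f x + g x) = rint mu f + rint mu g.
Proof.
by move=> cf cg; apply: RintegralD => //; exact: integrable_bmeas.
Qed.

Lemma rintZ mu (c : R) h : bmeas h ->
  rint mu (fun x => c * h x) = c * rint mu h.
Proof.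
by move=> ch; apply: RintegralZl => //; exact: integrable_bmeas.
Qed.

Lemma rint_cst mu (c : R) : rint mu (fun=> c) = c.
Proof.
have -> : rint mu (fun=> c) = c * fine (mu setT) by exact: Rintegral_cst.
have -> : mu setT = 1%E by exact: probability_setT.
by rewrite mulr1.
Qed.

Lemma le_rint mu (f g : X -> R) : bmeas f -> bmeas g ->
  (forall x, f x <= g x) -> rint mu f <= rint mu g.
Proof.
by move=> cf cg fg; apply: le_Rintegral => //; exact: integrable_bmeas.
Qed.

Lemma rint_bound mu h (M : R) : bmeas h -> (forall x, `|h x| <= M) ->
  `|rint mu h| <= M.
Proof.
move=> ch hM; rewrite ler_norml -{1}(rint_cst mu (- M)) -{2}(rint_cst mu M).
by apply/andP; split; apply: le_rint => // [|x]; try (exact: bmeas_cst);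
  have := hM x; rewrite ler_norml => /andP[].
Qed.

Lemma rint_sum mu (n : nat) (F : nat -> X -> R) :
  (forall i, (i < n)%N -> bmeas (F i)) ->
  rint mu (fun x => \sum_(i < n) F i x) = \sum_(i < n) rint mu (F i).
Proof.
elim: n => [|n IH] cF.
  by under eq_fun do rewrite big_ord0; rewrite rint_cst big_ord0.
under eq_fun do rewrite big_ord_recr/=.
rewrite big_ord_recr/= rintD; last 2 first.
- by apply: bmeas_sum => i ni; apply: cF; exact: ltnW.
- exact: cF.
by rewrite IH// => i ni; apply: cF; exact: ltnW.
Qed.

Lemma rint_indic mu (A : set (borelX X)) : measurable A ->
  rint mu (\1_A : X -> R) = fine (mu A).
Proof. by move=> mA; rewrite /rint integral_indic// setIT. Qed.

Lemma bmeas_indic (A : set (borelX X)) : measurable A -> bmeas (\1_A : X -> R).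
Proof.
move=> mA; split; last exact: measurable_indic.
by exists 1 => x; rewrite indicE; case: (_ \in _); rewrite ?normr1 ?normr0.
Qed.

End continuous_integral.

(** * Counting the integer levels below a real number *)

Section layer_cake.
Context {R : realType}.

(** The sum counts the integers from 1 to [M] that do not exceed [t]. The induction also carries the
    bound by [M], which settles the case where the new level is reached. *)
Lemma sum_layers_le (t : R) (M : nat) : 0 <= t ->
  \sum_(i < M) (i.+1%:R <= t)%R%:R <= t.
Proof.
move=> t0; suff : \sum_(i < M) (i.+1%:R <= t)%R%:R <= t /\
    \sum_(i < M) (i.+1%:R <= t)%R%:R <= M%:R :> R by case.
elim: M => [|M [IHt IHM]]; first by rewrite big_ord0.
rewrite big_ord_recr/=; have [Mt|Mt] := boolP (M.+1%:R <= t); last first.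
  by rewrite addr0; split => //; apply: le_trans IHM _; rewrite ler_nat.
have M1 : \sum_(i < M) (i.+1%:R <= t)%R%:R + 1 <= M.+1%:R :> R.
  by rewrite -natr1 lerD2r.
by split => //; exact: le_trans Mt.
Qed.

Lemma le_sum_layers (t : R) (M : nat) : t <= M%:R ->
  t <= 1 + \sum_(i < M) (i.+1%:R <= t)%R%:R.
Proof.
elim: M => [|M IH] tM.
  by rewrite big_ord0 addr0; apply: le_trans tM _.
have [/IH tM'|Mt] := leP t M%:R.
  by apply: le_trans tM' _; rewrite big_ord_recr/= lerD2l lerDl.
apply: le_trans tM _; rewrite -natr1 addrC lerD2l big_ord_recr/=.
rewrite (eq_bigr (fun=> 1)) => [|i _]; last first.
  by rewrite (le_trans _ (ltW Mt))// ler_nat.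
by rewrite sumr_const card_ord lerDl.
Qed.

End layer_cake.

(** * Riesz representation *)

Section Riesz.
Context {R : realType} {X : pointedMetricType R}.
Hypothesis compactX : compact [set: X].
Variable L : (X -> R) -> R.
Hypothesis LD : forall f g, bdd f -> bdd g -> L (fun x => f x + g x) = L f + L g.
Hypothesis le_L : forall f g, bdd f -> bdd g -> (forall x, f x <= g x) -> L f <= L g.
Hypothesis L_cst : forall c, L (fun=> c) = c.

Let l (A : set X) : R := L (\1_A).

Let bdd1 (A : set X) : bdd (\1_A : X -> R).
Proof.
by exists 1 => x; rewrite indicE; case: (_ \in _); rewrite ?normr1 ?normr0.
Qed.

Let L_natmul (N : nat) f : bdd f ->
  bdd (fun x => N%:R * f x) /\ L (fun x => N%:R * f x) = N%:R * L f.
Proof.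
move=> bf; elim: N => [|N [bN LN]].
  under eq_fun do rewrite mul0r.
  by split; [exact: bdd_cst|rewrite L_cst mul0r].
under eq_fun do rewrite -natr1 mulrDl mul1r.
by split; [exact: bdd_add|rewrite LD// LN -natr1 mulrDl mul1r].
Qed.

Let L_sum (N : nat) (F : nat -> X -> R) : (forall i, bdd (F i)) ->
  bdd (fun x => \sum_(i < N) F i x) /\
  L (fun x => \sum_(i < N) F i x) = \sum_(i < N) L (F i).
Proof.
move=> bF; elim: N => [|N [bN LN]].
  under eq_fun do rewrite big_ord0.
  by split; [exact: bdd_cst|rewrite L_cst big_ord0].
under eq_fun do rewrite big_ord_recr/=.
by split; [exact: bdd_add|rewrite LD// LN big_ord_recr].
Qed.

(** For nonnegative [h], the layer sums of [l] and of [mu] over the closed superlevel sets of [h]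
    compare [L h] with the integral. Adding a constant, fixed by both functionals, removes the sign
    condition. Replacing [h] by its opposite gives the reverse inequality. *)
Lemma riesz_probability : exists mu : probability (borelX X) R,
  forall h : X -> R, continuous h -> rint mu h = L h.
Proof.
have [|||||mu muE] := @content_dominated R X compactX l.
- rewrite /l -[RHS](L_cst 0); congr L; apply/funext => x.
  by rewrite indicE in_set0.
- rewrite /l -[RHS](L_cst 1); congr L; apply/funext => x.
  by rewrite indicE in_setT.
- move=> A B AB; apply: le_L => // x; rewrite !indicE ler_nat.
  by case: (boolP (x \in A)) => // xA; rewrite mem_set//; apply: AB; exact: set_mem.
- move=> A B; rewrite -LD//; apply: le_L => //; first exact: bdd_add.
  by move=> x; rewrite !indicE in_setU -natrD ler_nat; case: (x \in A); case: (x \in B).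
- move=> A B AB; rewrite -LD//; congr L; apply/funext => x.
  rewrite !indicE in_setU -natrD.
  case: (boolP (x \in A)) => //; case: (boolP (x \in B)) => // /set_mem xB /set_mem xA.
  by have : (A `&` B) x by []; rewrite AB.
exists mu.
have pos (h : X -> R) : continuous h -> (forall x, 0 <= h x) -> L h <= rint mu h.
  move=> ch h0; have bh := continuous_bdd compactX ch.
  (* Integer layers lose at most one unit whatever the size of the function; scaling [h] by [N]
     makes this loss negligible. *)
  suff key (N : nat) : N%:R * (L h - rint mu h) <= 1.
    rewrite leNgt; apply/negP; rewrite -subr_gt0 => d0.
    have := key (Num.truncn (L h - rint mu h)^-1).+1; apply/negP.
    by rewrite -ltNge -ltr_pdivrMr// mul1r truncnS_gt.
  pose g x := N%:R * h x.
  have cg : continuous g.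
    by move=> x; apply: cvgM; [exact: cvg_cst|exact: ch].
  have [M gM] := continuous_bdd compactX cg.
  pose C (i : nat) := [set x | i.+1%:R <= g x].
  have cC i : closed (C i).
    apply: (@preimage_closed _ _ g [set t | i.+1%:R <= t]); last exact: closed_ge.
    by move=> x *; exact: cg.
  have iE x i : \1_(C i) x = (i.+1%:R <= g x)%R%:R :> R.
    by rewrite indicE; congr (_ %:R); congr nat_of_bool; apply/idP/idP; rewrite inE.
  pose n := (Num.truncn M).+1.
  have -> : N%:R * (L h - rint mu h) = L g - rint mu g.
    by rewrite mulrBr -(L_natmul N bh).2 -rintZ//; exact: bmeas_continuous.
  have [b1 L1] := L_sum n (fun i => bdd1 (C i)).
  have up : L g <= 1 + \sum_(i < n) l (C i).
    rewrite -L1 -{1}(L_cst 1) -LD//; last exact: bdd_cst.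
    apply: le_L => [||x]; first exact: continuous_bdd.
      by apply: bdd_add => //; exact: bdd_cst.
    under eq_bigr do rewrite iE.
    apply: le_sum_layers; apply: le_trans (ler_norm _) _; apply: le_trans (gM x) _.
    by apply: ltW; exact: truncnS_gt.
  have m1 i : bmeas (\1_(C i) : X -> R).
    by apply: bmeas_indic; exact: borel_closed.
  have dn : \sum_(i < n) l (C i) <= rint mu g.
    apply: (@le_trans _ _ (rint mu (fun x => \sum_(i < n) \1_(C i) x))).
      rewrite (@rint_sum _ _ mu n (fun i => \1_(C i)))//; apply: ler_sum => i _.
      rewrite rint_indic; last exact: borel_closed.
      rewrite -lee_fin fineK; first exact: muE.
      by apply: fin_num_measure; exact: borel_closed.
    apply: le_rint; first by apply: (@bmeas_sum _ _ n (fun i => \1_(C i))).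
      exact: bmeas_continuous.
    move=> x; under eq_bigr do rewrite iE.
    by apply: sum_layers_le; rewrite mulr_ge0.
  by rewrite lerBlDr; apply: le_trans up _; rewrite lerD2l.
have le_rint_L (h : X -> R) : continuous h -> L h <= rint mu h.
  move=> ch; have bh := continuous_bdd compactX ch; have [M hM] := bh.
  have cM : continuous (fun x => h x + M).
    by move=> x; apply: cvgD; [exact: ch|exact: cvg_cst].
  have := pos _ cM; rewrite LD ?L_cst//; last exact: bdd_cst.
  rewrite rintD ?rint_cst; [|exact: bmeas_continuous|exact: bmeas_cst].
  rewrite lerD2r; apply=> x; rewrite -lerBlDr sub0r.
  by have := hM x; rewrite ler_norml => /andP[].
move=> h ch; apply/eqP; rewrite eq_le le_rint_L// andbT.
have cN : continuous (fun x => - h x) by move=> x; apply: cvgN; exact: ch.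
have bh := continuous_bdd compactX ch.
have := le_rint_L _ cN.
have -> : L (fun x => - h x) = - L h.
  apply/eqP; rewrite -addr_eq0 -LD//; last exact: bdd_opp.
  by under eq_fun do rewrite addNr; rewrite L_cst.
have -> : (fun x => - h x) = (fun x => -1 * h x).
  by apply/funext => x; rewrite mulN1r.
by rewrite rintZ ?mulN1r ?lerN2//; exact: bmeas_continuous.
Qed.

End Riesz.

(** * Empirical measures and invariance *)

Section empirical_limits.
Context {R : realType} {X : pointedMetricType R}.
Hypothesis compactX : compact [set: X].
Variable T : X -> X.

Lemma birkhoff_bound (h : X -> R) (M : R) n x : (forall y, `|h y| <= M) ->
  `|birkhoff T h n x| <= n%:R * M.
Proof.
move=> hM; apply: le_trans (ler_norm_sum _ _ _) _.
by rewrite mulr_natl -[n in leRHS]card_ord -sumr_const; apply: ler_sum.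
Qed.

Lemma average_bound (h : X -> R) (M : R) n x : (forall y, `|h y| <= M) ->
  `|n%:R^-1 * birkhoff T h n x| <= M.
Proof.
move=> hM; have M0 : 0 <= M by exact: le_trans (hM x).
case: n => [|n]; first by rewrite invr0 mul0r normr0.
by rewrite normrM gtr0_norm ?invr_gt0// ler_pdivrMl// birkhoff_bound.
Qed.

Lemma birkhoffD (f g : X -> R) n x :
  birkhoff T (fun y => f y + g y) n x = birkhoff T f n x + birkhoff T g n x.
Proof. by rewrite /birkhoff big_split. Qed.

(** Along one ultrafilter containing [S] and all tails, the orbit averages of every bounded function
    converge, and the limit functional satisfies the Riesz hypotheses. Members of the ultrafilter
    are nonempty, so finitely many test functions are approximated at a common time of [S]. *)
Lemma empirical_cluster (x : X) (S : set nat) :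
  (forall N, exists2 n, (N <= n)%N & S n) ->
  exists mu : probability (borelX X) R,
    forall (hs : seq (X -> R)) (e : R), (forall h, h \in hs -> continuous h) ->
      0 < e -> forall N, exists n, [/\ (N <= n)%N, (0 < n)%N, S n &
        forall h, h \in hs -> `|n%:R^-1 * birkhoff T h n x - rint mu h| < e].
Proof.
move=> Sinf.
have PF : ProperFilter (within S \oo).
  apply: Build_ProperFilter_ex => A [N _ NA].
  by have [n Nn Sn] := Sinf N; exists n; exact: NA.
have [G [uG FG]] := ultraFilterLemma PF.
have Goo (A : set nat) : (\oo : set_system nat) A -> G A.
  by move=> [N _ NA]; apply: FG; exists N => // n Nn _; exact: NA.
have GS : G S by apply: FG; exact: withinT.
pose A (h : X -> R) (n : nat) : R := n%:R^-1 * birkhoff T h n x.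
pose L (h : X -> R) : R := lim (A h @ G).
(* The averages stay in a compact segment, where an ultrafilter converges to any of its cluster
   points. *)
have cvgL (h : X -> R) : bdd h -> A h @ G --> L h.
  move=> [M hM].
  have /= := @segment_compact R (- M) M.
  move=> /(_ (A h @ G) _)[|l [_ lG]].
  - suff : G (A h @^-1` `[- M, M]) by [].
    by apply: filterE => n /=; rewrite in_itv/= -ler_norml average_bound.
  - apply/cvg_ex; exists l => V Vl.
    have [//|GV] := in_ultra_setVsetC (A h @^-1` V) uG.
    by have [t []] := lG (~` V) V GV Vl.
have [f g bf bg|f g bf bg fg|c|mu muE] := @riesz_probability R X compactX L.
- apply: cvg_lim => //; rewrite (_ : A _ = A f + A g).
    by apply: cvgD; exact: cvgL.
  by apply/funext => n; rewrite /A birkhoffD mulrDr.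
- apply: (ler_cvg_to (cvgL _ bf) (cvgL _ bg)); apply: nearW => n.
  by rewrite ler_wpM2l ?invr_ge0// ler_sum.
(* At time 0 the average is 0 rather than [c], so only positive times are compared. *)
- apply: cvg_lim => //; apply: cvg_trans (@cvg_cst _ c _ G _).
  apply: near_eq_cvg; apply: Goo; exists 1%N => // n /= n0.
  by rewrite /A /birkhoff sumr_const card_ord -[c *+ n]mulr_natl mulrA mulVf ?mul1r// pnatr_eq0 -lt0n.
exists mu => hs e hsc e0 N.
have Ghs : G [set n | forall h, h \in hs -> `|A h n - rint mu h| < e].
  elim: hs hsc => [|h hs IH] hsc; first by apply: filterS (@filterT _ G _).
  have {}IH : G [set n | forall h, h \in hs -> `|A h n - rint mu h| < e].
    by apply: IH => h' hh; apply: hsc; rewrite inE hh orbT.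
  have ch : continuous h by apply: hsc; exact: mem_head.
  have := cvgL h (continuous_bdd compactX ch); rewrite -(muE h ch).
  move=> /cvgr_dist_lt/(_ e e0) Gh.
  apply: filterS (filterI IH Gh) => n [IHn Ghn] k; rewrite inE => /predU1P[->|].
    by rewrite distrC.
  exact: IHn.
have [n [[? ?] [? ?]]] := filter_ex (filterI
  (filterI (Goo _ (nbhs_infty_ge N)) (Goo _ (nbhs_infty_gt 0))) (filterI GS Ghs)).
by exists n; split.
Qed.

End empirical_limits.

(** * Approximation of indicators of closed sets by continuous functions *)

Section distance_to_set.
Context {R : realType} {X : pointedMetricType R}.
Implicit Types (C : set X) (y z : X).

Lemma lipschitz1_continuous (g : X -> R) :
  (forall y z, g y <= g z + mdist y z) -> continuous g.
Proof.
move=> gL y; apply/cvgrPdist_lt => e e0.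
have : nbhs y (ball y e) by exact: nbhsx_ballx.
apply: filterS => z; rewrite ballEmdist /= => yz.
rewrite ltr_norml; apply/andP; split.
  rewrite ltrNl opprB; apply: le_lt_trans yz.
  by rewrite lerBlDl metric_sym; exact: gL.
by apply: le_lt_trans yz; rewrite lerBlDl; exact: gL.
Qed.

Definition dist_to C y : R := inf [set mdist y c | c in C].

Lemma dist_to_le C y c : C c -> dist_to C y <= mdist y c.
Proof.
move=> Cc; apply: ge_inf; last by exists c.
by exists 0 => _ [z _ <-]; exact: mdist_ge0.
Qed.

Lemma le_dist_to C y (e : R) : C !=set0 -> (forall c, C c -> e <= mdist y c) ->
  e <= dist_to C y.
Proof.
move=> [c Cc] eC; apply: lb_le_inf; first by exists (mdist y c), c.
by move=> _ [z Cz <-]; exact: eC.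
Qed.

Lemma dist_to_continuous C : C !=set0 -> continuous (dist_to C).
Proof.
move=> C0; apply: lipschitz1_continuous => y z.
rewrite -lerBlDr; apply: le_dist_to => // c Cc; rewrite lerBlDr addrC.
by apply: le_trans (dist_to_le y Cc) _; exact: metric_triangle.
Qed.

(* The functions (1 - min(1, d(., C)))^k decrease to the indicator of [C]. *)
Lemma closed_indic_approx C : closed C -> exists h : nat -> X -> R,
  [/\ forall k, continuous (h k), forall k x, `|h k x| <= 1 &
      forall x, h ^~ x @ \oo --> (\1_C x : R)].
Proof.
move=> cC; have [->|/set0P C0] := eqVneq C set0.
  exists (fun=> fun=> 0); split => [k|k x|x].
  - exact: cst_continuous.
  - by rewrite normr0.
  - by rewrite indicE in_set0; exact: cvg_cst.
pose g x : R := 1 - Num.min 1 (dist_to C x).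
have d0 x : 0 <= dist_to C x by apply: le_dist_to => // c _; exact: mdist_ge0.
have g0 x : 0 <= g x by rewrite subr_ge0 ge_min lexx.
have g1 x : g x <= 1 by rewrite lerBlDr lerDl le_min ler01 d0.
have cg : continuous g.
  move=> x; apply: cvgB; first exact: cvg_cst.
  apply: (@continuous_min _ _ (cst 1) (dist_to C)); first exact: cst_continuous.
  exact: dist_to_continuous.
exists (fun k x => g x ^+ k); split => [k x|k x|x].
- by apply: (@continuous_comp _ _ _ g (fun t : R => t ^+ k)); [exact: cg|exact: exprn_continuous].
- by rewrite normrX exprn_ile1 ?normr_ge0// ger0_norm.
- rewrite indicE; have [/set_mem Cx|xC] := boolP (x \in C).
    have gx : g x = 1.
      rewrite /g (_ : dist_to C x = 0) ?subr0//; first by rewrite min_r// subr0.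
      by apply/eqP; rewrite eq_le d0 andbT -(mdistxx x) dist_to_le.
    by under eq_fun do rewrite gx expr1n; exact: cvg_cst.
  apply: cvg_expr; rewrite ger0_norm// ltrBlDr ltrDl lt_min ltr01/=.
  have : (~` C) x by move=> /mem_set; apply/negP.
  have := closed_openC cC; rewrite openE => /[apply] /nbhs_ballP[e /= e0 eC].
  apply: lt_le_trans e0 _; apply: le_dist_to => // c Cc.
  by rewrite leNgt; apply/negP => xc; apply: (eC c) => //; rewrite ballEmdist.
Qed.

End distance_to_set.

(** * Invariance tested on continuous functions *)

Section invariant_measures.
Context {R : realType} {X : pointedMetricType R}.
Hypothesis compactX : compact [set: X].
Variable T : X -> X.
Hypothesis contT : continuous T.

Lemma measurable_continuous_map : measurable_fun [set: borelX X] (T : borelX X -> borelX X).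
Proof.
apply: (@measurability _ _ (borelX X) (borelX X) setT T (@open X)) => //.
move=> _ [U oU <-]; rewrite setTI.
apply: sub_sigma_algebra; apply: open_comp => // x _; exact: contT.
Qed.

Lemma iter_continuous n : continuous (iter n T).
Proof.
elim: n => [|n IH] x; first exact: cvg_id.
by apply: continuous_comp; [exact: IH|exact: contT].
Qed.

Lemma comp_continuous_map (h : X -> R) : continuous h -> continuous (h \o T).
Proof. by move=> ch x; apply: continuous_comp; [exact: contT|exact: ch]. Qed.

Lemma comp_iter_continuous (h : X -> R) i : continuous h -> continuous (fun x => h (iter i T x)).
Proof.
move=> ch x; apply: (@continuous_comp _ _ _ (iter i T) h).
  exact: iter_continuous.
exact: ch.
Qed.

Lemma birkhoff_continuous (h : X -> R) n : continuous h -> continuous (birkhoff T h n).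
Proof.
move=> ch; elim: n => [|n IH].
  rewrite (_ : birkhoff T h 0 = cst 0); first exact: cst_continuous.
  by apply/funext => x; rewrite /birkhoff big_ord0.
rewrite (_ : birkhoff T h n.+1 = fun x => birkhoff T h n x + h (iter n T x)).
  by move=> x; apply: cvgD; [exact: IH|exact: comp_iter_continuous].
by apply/funext => x; rewrite /birkhoff big_ord_recr.
Qed.

Lemma rint_comp (mu : probability (borelX X) R) (h : X -> R) : continuous h ->
  Tinvariant T mu -> rint mu (h \o T) = rint mu h.
Proof.
move=> ch inv; rewrite /rint; congr fine.
pose mT := measurable_continuous_map.
rewrite -[LHS](@integral_pushforward _ _ (borelX X) (borelX X) R T mT mu setT (EFin \o h)) //.
- apply: eq_measure_integral => A mA _; exact: inv.
- by apply/measurable_EFinP; exact: continuous_measurable.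
- by rewrite preimage_setT; exact: (integrable_bmeas mu (bmeas_continuous compactX (comp_continuous_map ch))).
Qed.

Lemma rint_birkhoff (mu : probability (borelX X) R) (h : X -> R) n :
  continuous h -> Tinvariant T mu -> rint mu (birkhoff T h n) = n%:R * rint mu h.
Proof.
move=> ch inv.
have ci i : continuous (fun x => h (iter i T x)) by exact: comp_iter_continuous.
rewrite (@rint_sum _ _ mu n (fun i x => h (iter i T x))); last first.
  by move=> i _; exact: bmeas_continuous.
rewrite (eq_bigr (fun=> rint mu h)) => [|i _].
  by rewrite sumr_const card_ord mulr_natl.
elim: (i : nat) => // k IH; rewrite -IH -(rint_comp (ci k) inv).
by congr rint; apply/funext => x /=; rewrite -iterSr.
Qed.

(** Dominated convergence carries the hypothesis from continuous functions to indicators of closed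
    sets. These sets are stable under intersection and generate the Borel sets, so uniqueness of
    measures concludes. *)
Lemma rint_comp_invariant (mu : probability (borelX X) R) :
  (forall h : X -> R, continuous h -> rint mu (h \o T) = rint mu h) ->
  Tinvariant T mu.
Proof.
move=> muT A mA; pose mT := measurable_continuous_map.
(* A general map [S] lets the same convergence serve for [T] and for the identity. *)
have cvg_rint (S : X -> X) C (h : nat -> X -> R) : continuous S ->
    (forall k, continuous (h k)) -> (forall k x, `|h k x| <= 1) ->
    (forall x, h ^~ x @ \oo --> (\1_C x : R)) -> closed C ->
    (fun k => \int[mu]_x ((h k (S x))%:E))%E @ \oo --> mu (S @^-1` C).
  move=> cS ch h1 hC cC.
  have cSC : closed (S @^-1` C).
    by apply: (@preimage_closed _ _ S) => // x _; exact: cS.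
  have -> : mu (S @^-1` C) = (\int[mu]_x ((\1_C (S x))%:E))%E.
    have -> : (fun x => (\1_C (S x) : R)%:E) = (fun x => (\1_(S @^-1` C) x)%:E).
      by apply/funext => x.
    by rewrite integral_indic ?setIT//; exact: borel_closed.
  apply: (@dominated_cvg _ (borelX X) R mu setT _ _ _ (cst 1%E)) => //.
  - move=> k; apply/measurable_EFinP; apply: continuous_measurable => x.
    by apply: (@continuous_comp _ _ _ S (h k)); [exact: cS|exact: ch].
  - by move=> x _; apply: cvg_EFin; [exact: nearW|exact: hC].
  - exact: (integrable_bmeas mu (@bmeas_cst R X 1)).
  - by move=> k x _; rewrite abse_EFin lee_fin.
apply: (@measure_unique _ R (borelX X) (@closed X) (fun=> setT) _ _ _ _
  (pushforward mu (T : borelX X -> borelX X)) mu) => //.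
- rewrite eqEsubset; split; apply: smallest_sub.
  + exact: smallest_sigma_algebra.
  + move=> U oU; rewrite -[U]setCK -setTD; apply: sigma_algebraCD.
    by apply: sub_sigma_algebra; exact: open_closedC.
  + exact: smallest_sigma_algebra.
  + by move=> C cC; exact: borel_closed.
- by move=> B C cB cC; exact: closedI.
- by rewrite -subTset => x _; exists 0%N.
- move=> C cC; have [h [ch h1 hC]] := closed_indic_approx cC.
  have c1 := cvg_rint T C h contT ch h1 hC cC.
  have c2 := cvg_rint idfun C h (fun x => cvg_id) ch h1 hC cC.
  apply: etrans (esym (cvg_lim (@ereal_hausdorff R) c1)) _.
  apply: etrans _ (cvg_lim (@ereal_hausdorff R) c2).
  congr (lim (_ @ \oo)); apply/funext => k.
  have ik (g : X -> R) : continuous g -> (\int[mu]_x (g x)%:E \is a fin_num)%E.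
    by move=> cg; apply: integrable_fin_num => //; apply: integrable_bmeas; exact: bmeas_continuous.
  rewrite -[LHS]fineK; last exact: ik (comp_continuous_map (ch k)).
  rewrite -[RHS]fineK; last exact: ik (ch k).
  by congr EFin; exact: muT.
- move=> _; exact: le_lt_trans (probability_le1 mu measurableT) (ltry 1).
Qed.

End invariant_measures.

(** * Asymptotically additive potentials *)

Section asymptotically_additive.
Context {R : realType} {X : pointedMetricType R}.
Hypothesis compactX : compact [set: X].
Variable T : X -> X.
Hypothesis contT : continuous T.
Implicit Types (f : nat -> X -> R) (mu : probability (borelX X) R).

Lemma AAP_approx f (e : R) : AAP T f -> 0 < e ->
  exists h : X -> R, continuous h /\ exists N, forall n, (N <= n)%N ->
    forall x, `|f n x - birkhoff T h n x| <= n%:R * e.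
Proof.
move=> [_ fT] e0; have [h [ch [eta [etae [N hN]]]]] := fT e e0.
exists h; split => //; exists N => n Nn x.
by apply: le_trans (hN n Nn x) _; rewrite ler_wpM2l// ltW.
Qed.

Lemma AAP_rint_approx f (h : X -> R) mu (e : R) n : AAP T f -> continuous h ->
  Tinvariant T mu -> (0 < n)%N ->
  (forall x, `|f n x - birkhoff T h n x| <= n%:R * e) ->
  `|n%:R^-1 * rint mu (f n) - rint mu h| <= e.
Proof.
move=> [cf _] ch inv n0 fh.
have n0' : 0 < n%:R :> R by rewrite ltr0n.
have -> : n%:R^-1 * rint mu (f n) - rint mu h =
    n%:R^-1 * (rint mu (f n) - rint mu (birkhoff T h n)).
  by rewrite (rint_birkhoff compactX contT)// mulrBr mulKf// gt_eqF.
have bf : bmeas (f n) by exact (bmeas_continuous compactX (cf n n0)).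
have bh : bmeas (birkhoff T h n).
  by apply: bmeas_continuous => //; exact: birkhoff_continuous.
have bN : bmeas (fun x => -1 * birkhoff T h n x) by apply: bmeasM => //; exact: bmeas_cst.
have -> : rint mu (f n) - rint mu (birkhoff T h n) =
    rint mu (fun x => f n x + -1 * birkhoff T h n x).
  by rewrite rintD// rintZ// mulN1r.
rewrite normrM gtr0_norm ?invr_gt0// ler_pdivrMl//.
by apply: rint_bound => [|x]; [exact: bmeasD|rewrite mulN1r].
Qed.

(** By invariance, the normalized integrals are eventually within any given tolerance of a fixed
    number [rint mu h], hence form a Cauchy sequence. This makes the [limn] in [pstar] a true
    limit. *)
Lemma pstar_cvg f mu : AAP T f -> Tinvariant T mu ->
  (fun n => n%:R^-1 * rint mu (f n)) @ \oo --> pstar f mu.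
Proof.
move=> fT inv; apply/cauchy_cvgP/cauchy_exP => e e0.
have e20 : 0 < e / 2 by rewrite divr_gt0.
have [h [ch [N hN]]] := AAP_approx fT e20.
exists (rint mu h); exists (maxn N 1) => // n /=; rewrite geq_max => /andP[Nn n0].
rewrite /ball /= distrC.
apply: (@le_lt_trans _ _ (e / 2)); last by rewrite ltr_pdivrMr// ltr_pMr// ltr1n.
by apply: AAP_rint_approx => //; exact: hN.
Qed.

Lemma AAP_pstar_approx f mu (e : R) : AAP T f -> Tinvariant T mu -> 0 < e ->
  exists h : X -> R, [/\ continuous h, `|pstar f mu - rint mu h| <= e &
    exists N, forall n, (N <= n)%N ->
    forall x, `|f n x - birkhoff T h n x| <= n%:R * e].
Proof.
move=> fT inv e0; have [h [ch [N hN]]] := AAP_approx fT e0.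
exists h; split => //; last by exists N.
have c : (fun n => `|n%:R^-1 * rint mu (f n) - rint mu h|) @ \oo --> `|pstar f mu - rint mu h|.
  by apply: cvg_norm; apply: cvgB; [exact: pstar_cvg|exact: cvg_cst].
apply: (ler_cvg_to c (@cvg_cst _ e _ _ _)).
exists (maxn N 1) => // n /=; rewrite geq_max => /andP[Nn n0].
by apply: AAP_rint_approx => //; exact: hN.
Qed.

(** This is [Vlim] with the times confined to [S]: all times for a plain limit point, or the times
    where a ratio exceeds a given level. *)
Definition empirical_cluster_along (S : set nat) (x : X) mu :=
  forall (hs : seq (X -> R)) (e : R), (forall h, h \in hs -> continuous h) ->
    0 < e -> forall N, exists n, [/\ (N <= n)%N, (0 < n)%N, S n &
      forall h, h \in hs -> `|n%:R^-1 * birkhoff T h n x - rint mu h| < e].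

Lemma cluster_along_Vlim S x mu : empirical_cluster_along S x mu -> Vlim T x mu.
Proof.
by move=> muS hs e chs e0 N; have [n [? ? _ ?]] := muS hs e chs e0 N; exists n.
Qed.

Lemma Vlim_cluster_along x mu : Vlim T x mu -> empirical_cluster_along setT x mu.
Proof.
by move=> muS hs e chs e0 N; have [n [? [? ?]]] := muS hs e chs e0 N; exists n.
Qed.

(** The Birkhoff sum of [h \o T - h] telescopes to two boundary terms, so its average vanishes in
    the limit. Both functions are tested at the same time [n]. *)
Lemma cluster_along_invariant S x mu : empirical_cluster_along S x mu ->
  Tinvariant T mu.
Proof.
move=> muS; apply: rint_comp_invariant => // h ch.
have chT := comp_continuous_map contT ch.
apply/eqP; rewrite -subr_eq0 -normr_le0; apply/ler_addgt0Pr => e e0; rewrite add0r.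
have [M hM] := continuous_bdd compactX ch.
have M0 : 0 <= M by exact: le_trans (hM x).
have e3 : 0 < e / 3 by rewrite divr_gt0.
(* From this time on the boundary terms, at most [2 * M], average to at most [e / 3]. *)
pose N := (Num.truncn (2 * M / (e / 3))).+1.
have [|n [Nn n0 _ hn]] := muS [:: h; h \o T] (e / 3) _ e3 N.
  by move=> k; rewrite !inE => /orP[/eqP->|/eqP->].
have n0' : 0 < n%:R :> R by rewrite ltr0n.
have h1 := hn h (mem_head _ _).
have h2 : `|n%:R^-1 * birkhoff T (h \o T) n x - rint mu (h \o T)| < e / 3.
  by apply: hn; rewrite !inE eqxx orbT.
have h3 : `|n%:R^-1 * birkhoff T (h \o T) n x - n%:R^-1 * birkhoff T h n x| <= e / 3.
  rewrite -mulrBr normrM gtr0_norm ?invr_gt0// ler_pdivrMl//.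
  have -> : birkhoff T (h \o T) n x - birkhoff T h n x = h (iter n T x) - h x.
    rewrite /birkhoff -sumrB -(telescope_sumr (fun i => h (iter i T x)) (leq0n n)) big_mkord.
    by apply: eq_bigr => i _.
  apply: le_trans (ler_normB _ _) _; apply: le_trans (lerD (hM _) (hM _)) _.
  rewrite (_ : M + M = 2 * M); last by ring.
  rewrite -ler_pdivrMr//; apply: ltW.
  by apply: lt_le_trans (truncnS_gt _) _; rewrite ler_nat.
rewrite (_ : rint mu (h \o T) - rint mu h =
  (rint mu (h \o T) - n%:R^-1 * birkhoff T (h \o T) n x)
  + (n%:R^-1 * birkhoff T (h \o T) n x - n%:R^-1 * birkhoff T h n x)
  + (n%:R^-1 * birkhoff T h n x - rint mu h)); last by ring.
apply: le_trans (ler_normD _ _) _; apply: le_trans (lerD (ler_normD _ _) (lexx _)) _.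
rewrite distrC in h2.
have -> : e = e / 3 + e / 3 + e / 3 by field.
by rewrite !lerD// ltW.
Qed.

(** The potentials must be controlled at one common time, so their continuous approximants are
    gathered into a single list of test functions. *)
Lemma cluster_along_AAP S x mu (fs : seq (nat -> X -> R)) (e : R) N :
  empirical_cluster_along S x mu ->
  (forall f, f \in fs -> AAP T f) -> 0 < e ->
  exists n, [/\ (N <= n)%N, (0 < n)%N, S n &
    forall f, f \in fs -> `|f n x / n%:R - pstar f mu| < e].
Proof.
move=> muS fsT e0; have inv := cluster_along_invariant muS.
have e3 : 0 < e / 3 by rewrite divr_gt0.
have [hs [chs [N' hsP]]] : exists hs : seq (X -> R),
    (forall h, h \in hs -> continuous h) /\ exists N', forall f, f \in fs ->
      exists h, [/\ h \in hs, `|pstar f mu - rint mu h| <= e / 3 &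
        forall n, (N' <= n)%N -> forall x, `|f n x - birkhoff T h n x| <= n%:R * (e / 3)].
  elim: fs fsT => [|f fs IH] fsT; first by exists [::]; split => //; exists 0%N.
  have [|hs [chs [N1 hsP]]] := IH.
    by move=> g gfs; apply: fsT; rewrite inE gfs orbT.
  have [h [ch fh [N2 hN]]] := AAP_pstar_approx (fsT f (mem_head _ _)) inv e3.
  exists (h :: hs); split => [k|].
    by rewrite inE => /predU1P[->//|]; exact: chs.
  exists (maxn N1 N2) => g; rewrite inE => /predU1P[->|].
    exists h; split => //; first exact: mem_head.
    by move=> n; rewrite geq_max => /andP[_]; exact: hN.
  move=> /hsP[k [khs gk kN]]; exists k; split => //; first by rewrite inE khs orbT.
  by move=> n; rewrite geq_max => /andP[+ _]; exact: kN.
have [n [Nn n0 Sn hn]] := muS hs (e / 3) chs e3 (maxn N N').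
move: Nn; rewrite geq_max => /andP[Nn N'n].
exists n; split => // f /hsP[h [hhs fh /(_ n N'n x) fn]].
have n0' : 0 < n%:R :> R by rewrite ltr0n.
have h1 := hn h hhs.
have h2 : `|f n x / n%:R - n%:R^-1 * birkhoff T h n x| <= e / 3.
  by rewrite [f n x / _]mulrC -mulrBr normrM gtr0_norm ?invr_gt0// ler_pdivrMl.
rewrite (_ : f n x / n%:R - pstar f mu =
  (f n x / n%:R - n%:R^-1 * birkhoff T h n x)
  + (rint mu h - pstar f mu)
  + (n%:R^-1 * birkhoff T h n x - rint mu h)); last by ring.
rewrite distrC in fh.
apply: le_lt_trans (ler_normD _ _) _.
have -> : e = e / 3 + e / 3 + e / 3 by field.
by rewrite ler_ltD//; apply: le_trans (ler_normD _ _) _; rewrite lerD.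
Qed.

End asymptotically_additive.

(** * Ratios of potentials along an orbit *)

Section ratios.
Context {R : realType} {X : pointedMetricType R}.
Hypothesis compactX : compact [set: X].
Variable T : X -> X.
Hypothesis contT : continuous T.
Implicit Types (f g : nat -> X -> R) (mu : probability (borelX X) R).

(** The factor of [d] depends only on [A] and [s], so the tolerance can be fixed before [a] and [b]
    are chosen. *)
Lemma ratio_dist (a b A B s d : R) : 0 < s -> s <= b -> s <= B ->
  `|a - A| <= d -> `|b - B| <= d ->
  `|a / b - A / B| <= d * (s^-1 + `|A| * s^-1 ^+ 2).
Proof.
move=> s0 sb sB aA bB.
have b0 : 0 < b by exact: lt_le_trans sb.
have B0 : 0 < B by exact: lt_le_trans sB.
have d0 : 0 <= d by exact: le_trans aA.
have -> : a / b - A / B = (a - A) / b - A * ((b - B) / (b * B)).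
  by field; rewrite ?gt_eqF.
apply: le_trans (ler_normB _ _) _; rewrite mulrDr; apply: lerD.
  rewrite normrM (gtr0_norm (_ : 0 < b^-1)) ?invr_gt0//.
  by apply: ler_pM => //; [rewrite invr_ge0 ltW|rewrite lef_pV2].
rewrite normrM [d * _]mulrCA; apply: ler_wpM2l => //.
rewrite normrM (gtr0_norm (_ : 0 < (b * B)^-1)) ?invr_gt0 ?mulr_gt0//.
apply: ler_pM => //; first by rewrite invr_ge0 ltW// mulr_gt0.
by rewrite expr2 -invfM lef_pV2 ?posrE ?mulr_gt0// ler_pM// ltW.
Qed.

Lemma pstar_ge g mu (sigma : R) : AAP T g -> Tinvariant T mu ->
  (forall n x, (0 < n)%N -> sigma <= g n x / n%:R) -> sigma <= pstar g mu.
Proof.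
move=> gT inv gs; apply: (ler_cvg_to (@cvg_cst _ sigma _ _ _) (pstar_cvg compactX contT gT inv)).
exists 1%N => // n /= n0.
have n0' : 0 < n%:R :> R by rewrite ltr0n.
rewrite ler_pdivlMl// -(rint_cst mu (n%:R * sigma)).
apply: le_rint => [||x]; first exact: bmeas_cst.
  by apply: bmeas_continuous => //; exact: gT.1.
by rewrite mulrC -ler_pdivlMr// gs.
Qed.

Lemma cluster_along_ratio S x f g mu (sigma e : R) N :
  empirical_cluster_along T S x mu -> AAP T f -> AAP T g -> 0 < sigma ->
  (forall n y, (0 < n)%N -> sigma <= g n y / n%:R) -> 0 < e ->
  exists n, [/\ (N <= n)%N, S n &
    `|f n x / g n x - pstar f mu / pstar g mu| <= e].
Proof.
move=> muS fT gT s0 gs e0; have inv := cluster_along_invariant compactX contT muS.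
(* [K] is the factor in [ratio_dist], whence the tolerance [e / K] below. *)
pose K := sigma^-1 + `|pstar f mu| * sigma^-1 ^+ 2.
have K0 : 0 < K by rewrite ltr_pwDl ?invr_gt0// mulr_ge0// exprn_ge0// invr_ge0 ltW.
have [|n [Nn n0 Sn hn]] := cluster_along_AAP (fs := [:: f; g]) compactX contT N muS _ (divr_gt0 e0 K0).
  by move=> k; rewrite !inE => /orP[/eqP->|/eqP->].
exists n; split => //.
have n0' : n%:R != 0 :> R by rewrite pnatr_eq0 -lt0n.
have -> : f n x / g n x = (f n x / n%:R) / (g n x / n%:R).
  by rewrite invfM invrK mulrACA mulVf// mulr1.
rewrite -[leRHS](divfK (lt0r_neq0 K0)).
apply: ratio_dist => //; first exact: gs.
- exact: pstar_ge gs.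
- by apply: ltW; apply: hn; rewrite !inE eqxx.
- by apply: ltW; apply: hn; rewrite !inE eqxx orbT.
Qed.

(** At arbitrarily late times the ratio at [x] is close to that of [mu], while along all times it
    tends to [alpha]. *)
Lemma Vlim_ratio x phi psi mu (sigma alpha : R) : Vlim T x mu ->
  AAP T phi -> AAP T psi -> 0 < sigma ->
  (forall n y, (0 < n)%N -> sigma <= psi n y / n%:R) ->
  levelset phi psi alpha x -> pstar phi mu / pstar psi mu = alpha.
Proof.
move=> /Vlim_cluster_along muS phiT psiT s0 psis xE.
apply/eqP; rewrite -subr_eq0 -normr_le0; apply/ler_addgt0Pr => e e0; rewrite add0r.
have e2 : 0 < e / 2 by rewrite divr_gt0.
have /cvgrPdist_lt/(_ _ e2)[N _ NE] :
  (fun n => phi n x / psi n x) @ \oo --> alpha := xE.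
have [n [Nn _ hn]] := cluster_along_ratio N muS phiT psiT s0 psis e2.
have := NE n Nn => /= {}NE.
rewrite -(subrKA (phi n x / psi n x)) (splitr e).
apply: le_trans (ler_normD _ _) _; apply: lerD; first by rewrite distrC.
by rewrite distrC ltW.
Qed.

Lemma limn_esup_frequently (u : nat -> R) (c : R) :
  (c%:E < limn_esup (EFin \o u))%E -> forall N, exists2 n, (N <= n)%N & c < u n.
Proof.
move=> cu N; apply: contrapT => /forall2NP uc.
suff : (limn_esup (EFin \o u) <= c%:E)%E by rewrite leNgt cu.
apply: (@le_trans _ _ (ereal_sup ((EFin \o u) @` [set n | (N <= n)%N]))).
  by apply: ereal_inf_lbound; exists [set n | (N <= n)%N] => //; exact: nbhs_infty_ge.
apply: ge_ereal_sup => _ [n /= Nn <-]; rewrite lee_fin leNgt.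
by apply/negP; case: (uc n).
Qed.

(* An ultrafilter containing the times where [f n x / g n x > c] yields a
   cluster measure whose ratio is at least [c]. *)
Lemma limsup_ratio_attained x f g (sigma c : R) : AAP T f -> AAP T g ->
  0 < sigma -> (forall n y, (0 < n)%N -> sigma <= g n y / n%:R) ->
  (c%:E < limn_esup (fun n => (f n x / g n x)%:E))%E ->
  exists2 mu, Vlim T x mu & c <= pstar f mu / pstar g mu.
Proof.
move=> fT gT s0 gs /limn_esup_frequently fq.
have [mu muS] := empirical_cluster compactX T x fq.
exists mu; first exact: cluster_along_Vlim muS.
apply/ler_addgt0Pr => e e0.
have [n [_ cn hn]] := cluster_along_ratio 0 muS fT gT s0 gs e0.
rewrite -lerBlDl; apply: le_trans hn; apply: le_trans (ler_norm _).
by rewrite lerB// ltW.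
Qed.

End ratios.

(** * Generic points of invariant measures *)

Section greedy_sampling.
Context {R : realType} {X : pointedMetricType R}.
Variable mu : probability (borelX X) R.
Variables (k : nat) (v : nat -> X -> R) (M : R).
Hypothesis bmeasv : forall i, (i < k)%N -> bmeas (v i).
Hypothesis v0 : forall i, (i < k)%N -> rint mu (v i) = 0.
Hypothesis vM : forall i x, (i < k)%N -> `|v i x| <= M.

(** The cross term of the expanded squares has integral zero, so some [x] makes it at most 1. The
    remaining squares add at most [k * M ^+ 2]. *)
Lemma greedy_step (s : nat -> R) : exists x, \sum_(i < k) (s i + v i x) ^+ 2 <=
  \sum_(i < k) s i ^+ 2 + (k%:R * M ^+ 2 + 1).
Proof.
pose w x := \sum_(i < k) s i * v i x.
have bw i : (i < k)%N -> bmeas (fun x => s i * v i x).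
  by move=> ik; apply: bmeasM; [exact: bmeas_cst|exact: bmeasv].
have w0 : rint mu w = 0.
  rewrite /w (@rint_sum _ _ mu k (fun i x => s i * v i x))// big1// => i _.
  by rewrite rintZ ?v0 ?mulr0//; exact: bmeasv.
have [x wx] : exists x, w x <= 2^-1.
  apply: contrapT => /forallNP wN.
  suff : 2^-1 <= rint mu w by rewrite w0 leNgt invr_gt0 ltr0n.
  rewrite -(rint_cst mu 2^-1); apply: le_rint => [||x]; first exact: bmeas_cst.
    exact: (@bmeas_sum _ _ k (fun i x => s i * v i x)).
  by rewrite leNgt; apply/negP => /ltW; exact: wN.
exists x.
have -> : \sum_(i < k) (s i + v i x) ^+ 2 =
    \sum_(i < k) s i ^+ 2 + (2 * w x + \sum_(i < k) v i x ^+ 2).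
  rewrite /w mulr_sumr -!big_split/=; apply: eq_bigr => i _; ring.
rewrite lerD2l addrC; apply: lerD; last by rewrite -ler_pdivlMl// mulr1.
rewrite mulr_natl -[k in leRHS]card_ord -sumr_const; apply: ler_sum => i _.
by rewrite -real_normK ?num_real// lerXn2r ?nnegrE ?vM// (le_trans (normr_ge0 _) (vM x (ltn_ord i))).
Qed.

(* Choosing each point greedily keeps the squared norm of the vector of sums
   growing at most linearly, so the sums themselves are sublinear. *)
Lemma greedy_sampling (e : R) : 0 < e -> exists (C : R) (xs : nat -> X),
  forall r i, (i < k)%N -> `|\sum_(j < r) v i (xs j)| <= r%:R * e + C.
Proof.
move=> e0; have [pk pkP] := choice greedy_step.
pose D := k%:R * M ^+ 2 + 1.
have D0 : 0 < D by rewrite ltr_pwDr// mulr_ge0// sqr_ge0.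
pose s := fix s r := if r is r'.+1 then fun i => s r' i + v i (pk (s r')) else fun=> 0.
(* The squared sum is at most [r * D], which is the product of [r * e] and [D / e], hence at most
   the square of their sum. *)
exists (D / e), (fun j => pk (s j)) => r i ik.
have sE : s r i = \sum_(j < r) v i (pk (s j)).
  by elim: r => [|r IH]; rewrite ?big_ord0// big_ord_recr/= -IH.
rewrite -sE; have sD : s r i ^+ 2 <= r%:R * D.
  have : \sum_(i < k) s r i ^+ 2 <= r%:R * D.
    elim: r {sE} => [|r IH]; first by rewrite mul0r big1// => j _; rewrite expr0n.
    by apply: le_trans (pkP (s r)) _; rewrite -natr1 mulrDl mul1r lerD2r.
  apply: le_trans; rewrite (bigD1 (Ordinal ik))//= lerDl.
  by apply: sumr_ge0 => j _; exact: sqr_ge0.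
have a0 : 0 <= r%:R * e by rewrite mulr_ge0// ltW.
have b0 : 0 <= D / e by rewrite divr_ge0// ltW.
rewrite -(@ler_pXn2r _ 2)// ?nnegrE ?addr_ge0// real_normK ?num_real//.
apply: le_trans sD _.
have -> : r%:R * D = (r%:R * e) * (D / e) by field; rewrite gt_eqF.
rewrite sqrrD; nra.
Qed.

End greedy_sampling.

(** * Gluing orbit segments by specification *)

Section extension.
Context {R : realType} {X : pointedMetricType R}.
Hypothesis compactX : compact [set: X].
Variable T : X -> X.
Hypothesis contT : continuous T.
Hypothesis specT : specification T.

Lemma birkhoff_add (h : X -> R) a b x :
  birkhoff T h (a + b) x = birkhoff T h a x + birkhoff T h b (iter a T x).
Proof.
rewrite /birkhoff big_split_ord/=; congr (_ + _); apply: eq_bigr => i _ /=.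
by rewrite addnC iterD.
Qed.

Lemma birkhoff_shadow (h : X -> R) (e : R) n x y :
  (forall p, (p < n)%N -> `|h (iter p T x) - h (iter p T y)| <= e) ->
  `|birkhoff T h n x - birkhoff T h n y| <= n%:R * e.
Proof.
move=> hxy; rewrite /birkhoff -sumrB; apply: le_trans (ler_norm_sum _ _ _) _.
by rewrite mulr_natl -[n in leRHS]card_ord -sumr_const; apply: ler_sum => i _; exact: hxy.
Qed.

Lemma uniform_continuity (h : X -> R) (e : R) : continuous h -> 0 < e ->
  exists2 d : R, 0 < d & forall x y, mdist x y < d -> `|h x - h y| <= e.
Proof.
move=> ch e0; have e20 : 0 < e / 2 by rewrite divr_gt0.
have cc := (compact_near_coveringP [set: X]).1 compactX.
have := cc nat \oo (fun N x => forall y, mdist x y < N.+1%:R^-1 -> `|h x - h y| <= e) _.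
case=> [x _|N _ NK]; last first.
  by exists N.+1%:R^-1 => [|x y]; [rewrite invr_gt0|exact: (NK N (leqnn _) x I)].
have /cvgrPdist_lt/(_ _ e20)/nbhs_ballP[d /= d0 hd] := ch x.
have d20 : 0 < d / 2 by rewrite divr_gt0.
near=> y N.
have Nd : N.+1%:R^-1 < d / 2.
  by near: N; exact: (near_infty_natSinv_lt (PosNum d20)).
move=> z yz.
have xy : ball x (d / 2) y by near: y; exact: nbhsx_ballx.
have xz : ball x d z.
  rewrite (splitr d); apply: ball_triangle xy _; rewrite ballEmdist/=.
  exact: lt_trans yz Nd.
have hy : `|h x - h y| < e / 2.
  by apply: hd; apply: le_ball xy; rewrite ler_pdivrMr// ler_pMr// ler1n.
rewrite -(subrKA (h x)) (splitr e); apply: le_trans (ler_normD _ _) _.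
by apply: lerD; [rewrite distrC ltW|exact: ltW (hd _ xz)].
Unshelve. all: by end_near.
Qed.

Lemma uniform_continuity_family (k : nat) (h : nat -> X -> R) (e : R) :
  (forall i, (i < k)%N -> continuous (h i)) -> 0 < e ->
  exists2 d : R, 0 < d & forall i x y, (i < k)%N -> mdist x y < d ->
    `|h i x - h i y| <= e.
Proof.
move=> + e0; elim: k => [|k IH] ch; first by exists 1.
have [|d1 d10 hd1] := IH; first by move=> i ik; apply: ch; exact: ltnW.
have [d2 d20 hd2] := uniform_continuity (ch k (ltnSn k)) e0.
exists (Num.min d1 d2) => [|i x y]; first by rewrite lt_min d10.
rewrite ltnS leq_eqVlt lt_min => /predU1P[->|ik] /andP[xy1 xy2]; first exact: hd2.
exact: hd1.
Qed.

Lemma bound_family (k : nat) (h : nat -> X -> R) :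
  (forall i, (i < k)%N -> continuous (h i)) ->
  exists2 B : R, 0 <= B & forall i x, (i < k)%N -> `|h i x| <= B.
Proof.
elim: k => [|k IH] ch; first by exists 0.
have [|B1 B10 hB1] := IH; first by move=> i ik; apply: ch; exact: ltnW.
have [B2 hB2] := continuous_bdd compactX (ch k (ltnSn k)).
exists (Num.max B1 B2) => [|i x]; first by rewrite le_max B10.
rewrite ltnS leq_eqVlt le_max => /predU1P[->|ik]; first by rewrite hB2 orbT.
by rewrite hB1.
Qed.

(* Specification glues to [z] a concatenation of many orbit segments whose
   starting points are a greedy sample of the Birkhoff sums along [mu]. *)
Lemma specification_extension (mu : probability (borelX X) R) (k : nat)
    (h : nat -> X -> R) (e d : R) :
  Tinvariant T mu -> (forall i, (i < k)%N -> continuous (h i)) ->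
  (forall i, (i < k)%N -> rint mu (h i) = 0) -> 0 < e -> 0 < d ->
  exists C : R, forall z L M, (0 < L)%N -> exists z',
    (forall p, (p < L)%N -> mdist (iter p T z') (iter p T z) < d) /\
    forall i n, (i < k)%N -> (n <= M)%N ->
      `|birkhoff T (h i) n (iter L T z')| <= n%:R * e + C.
Proof.
move=> inv ch h0 e0 d0.
(* One third each pays for the gaps, the shadowing errors and the sampling error. *)
pose eta := e / 3; have eta0 : 0 < eta by rewrite divr_gt0.
have [d' d'0 hd'] := uniform_continuity_family ch eta0.
have [B B0 hB] := bound_family ch.
have dd' : 0 < Num.min d d' by rewrite lt_min d0.
have [m mP] := specT dd'.
(* Segments are long enough for a gap of [m] steps, costing at most [m * B], to be absorbed by
   [n0 * eta]. *)
pose n0 := (Num.truncn (m%:R * B / eta)).+1.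
have n0P : m%:R * B <= n0%:R * eta.
  by rewrite -ler_pdivrMr//; apply: ltW; exact: truncnS_gt.
have [|||C1 [xs xsP]] := @greedy_sampling R X mu k (fun i => birkhoff T (h i) n0)
    (n0%:R * B) _ _ _ eta eta0.
- by move=> i ik; apply: bmeas_continuous => //; apply: birkhoff_continuous => //; exact: ch.
- by move=> i ik; rewrite (rint_birkhoff compactX contT) ?h0 ?mulr0//; exact: ch.
- by move=> i x ik; apply: birkhoff_bound => y; exact: hB.
pose l := (m + n0)%N.
(* [C1] comes from the sampling; [l * B] bounds the incomplete last cycle. *)
exists (C1 + l%:R * B) => z L M L0.
(* Segment 0 follows [z] for [L] steps; each later cycle of length [l] is a gap of [m] steps and a
   sampled segment of [n0] steps. The intervals of [specification] include both ends, hence the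
   predecessors in [b]. As [l] is positive, [M] cycles cover all times up to [M]. *)
pose a j := if j is j'.+1 then (L + j' * l + m)%N else 0%N.
pose b j := if j is j'.+1 then (L + j' * l + m + n0.-1)%N else L.-1.
pose ys j := if j is j'.+1 then xs j' else z.
have [||z' z'P] := mP M.+1 a b ys.
- by move=> [|j] _ //=; exact: leq_addr.
- by move=> [|j] _ /=; rewrite /l /n0; nia.
exists z'; split => [p pL|i n ik nM].
  have := z'P 0%N isT p; rewrite /= subn0 addn0 => /(_ _)/lt_le_trans; apply.
    by rewrite -ltnS prednK.
  by rewrite ge_min lexx.
pose y := iter L T z'.
have shadow j p : (j < M)%N -> (p < n0)%N ->
    `|h i (iter p T (iter (j * l + m) T y)) - h i (iter p T (xs j))| <= eta.
  move=> jM pn0; apply: hd' => //.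
  have := z'P j.+1 jM p; rewrite /= addKn => /(_ _)/lt_le_trans.
  rewrite /y -!iterD (_ : p + (j * l + m) + L = p + (L + j * l + m))%N; last by lia.
  by apply; [exact: pn0|rewrite ge_min lexx orbT].
have cycles q : (q <= M)%N ->
    `|birkhoff T (h i) (q * l) y - \sum_(j < q) birkhoff T (h i) n0 (xs j)|
      <= (q * n0)%:R * (2 * eta).
  elim: q => [_|q IH qM]; first by rewrite big_ord0 /birkhoff big_ord0 subrr normr0 mulr_ge0// mulr_ge0// ltW.
  rewrite (_ : q.+1 * l = q * l + m + n0)%N; last by rewrite /l; lia.
  rewrite !birkhoff_add big_ord_recr/=.
  have h1 := IH (ltnW qM).
  have h2 : `|birkhoff T (h i) m (iter (q * l) T y)| <= m%:R * B.
    by apply: birkhoff_bound => x; exact: hB.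
  have h3 := birkhoff_shadow (fun p => @shadow q p qM).
  rewrite (_ : _ + _ - _ = (birkhoff T (h i) (q * l) y - \sum_(j < q) birkhoff T (h i) n0 (xs j))
    + birkhoff T (h i) m (iter (q * l) T y)
    + (birkhoff T (h i) n0 (iter (q * l + m) T y) - birkhoff T (h i) n0 (xs q))); last by ring.
  apply: le_trans (ler_normD _ _) _.
  apply: le_trans (lerD (ler_normD _ _) (lexx _)) _.
  apply: le_trans (lerD (lerD h1 (le_trans h2 n0P)) h3) _.
  by rewrite (_ : q.+1 * n0 = q * n0 + n0)%N ?natrD; [lra|lia].
have l0 : (0 < l)%N by rewrite /l /n0 addnS.
pose q := (n %/ l)%N.
have qM : (q <= M)%N by apply: leq_trans nM; exact: leq_div.
rewrite -/y (divn_eq n l) -/q birkhoff_add.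
have h1 : `|birkhoff T (h i) (n %% l) (iter (q * l) T y)| <= l%:R * B.
  apply: (@le_trans _ _ ((n %% l)%:R * B)).
    by apply: birkhoff_bound => x; exact: hB.
  by rewrite ler_wpM2r// ler_nat ltnW// ltn_mod.
have h2 := cycles q qM.
have h3 := xsP q i ik.
have h4 : q%:R * eta <= (q * n0)%:R * eta.
  by rewrite ler_wpM2r ?(ltW eta0)// ler_nat /n0 leq_pmulr.
have h5 : (q * n0)%:R * (3 * eta) <= (q * l + n %% l)%:R * e.
  rewrite (_ : 3 * eta = e); last by rewrite /eta; field.
  rewrite ler_wpM2r ?(ltW e0)// ler_nat.
  by rewrite (leq_trans _ (leq_addr _ _))// leq_mul2l leq_addl orbT.
apply: le_trans (ler_normD _ _) _.
rewrite -[X in `|X| + _](subrK (\sum_(j < q) birkhoff T (h i) n0 (xs j))).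
apply: le_trans (lerD (ler_normD _ _) (lexx _)) _.
apply: le_trans (lerD (lerD h2 h3) h1) _.
move: h4 h5; lra.
Qed.

End extension.

(** * Limit of the glued orbits *)

Section generic_points.
Context {R : realType} {X : pointedMetricType R}.
Hypothesis compactX : compact [set: X].
Variable T : X -> X.
Hypothesis contT : continuous T.
Hypothesis specT : specification T.

(** The successive displacements are dominated by a geometric series, whose partial sums are the
    differences in [zjk]. The bound passes to a cluster point of [z] by continuity of each
    iterate. *)
Lemma cluster_point_shadow (z : nat -> X) (L : nat -> nat) :
  (forall k j, (k <= j)%N -> (L k <= L j)%N) ->
  (forall k p, (p < L k)%N -> mdist (iter p T (z k.+1)) (iter p T (z k)) < (2 ^+ k)^-1 :> R) ->
  exists x, forall k p, (p < L k)%N ->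
    mdist (iter p T x) (iter p T (z k)) <= 2 * (2 ^+ k)^-1 :> R.
Proof.
move=> Lmono zP.
have zjk k j p : (p < L k)%N -> mdist (iter p T (z (k + j)%N)) (iter p T (z k)) <=
    2 * (2 ^+ k)^-1 - 2 * (2 ^+ (k + j))^-1 :> R.
  move=> pL; elim: j => [|j IH]; first by rewrite addn0 mdistxx subrr.
  rewrite addnS; apply: le_trans (metric_triangle _ (iter p T (z (k + j)%N)) _) _.
  have pLj : (p < L (k + j))%N by apply: leq_trans pL (Lmono _ _ (leq_addr _ _)).
  apply: le_trans (lerD (ltW (zP _ _ pLj)) IH) _.
  rewrite exprS invfM; set u := (_ ^+ (k + j))^-1; lra.
have [x [_ xz]] : [set: X] `&` cluster (z @ \oo) !=set0.
  by apply: compactX; exact: filterT.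
exists x => k p pL; apply/ler_addgt0Pr => e e0.
have near_x : nbhs x [set y | mdist (iter p T x) (iter p T y) < e].
  have : nbhs x (iter p T @^-1` ball (iter p T x) e).
    by apply: (iter_continuous contT); exact: nbhsx_ballx.
  by apply: filterS => y; rewrite /= ballEmdist.
have tail : (z @ \oo) [set y | exists j, y = z (k + j)%N].
  by exists k => // n /= kn; exists (n - k)%N; rewrite subnKC.
have [y [[j ->] xy]] := xz _ _ tail near_x.
apply: le_trans (metric_triangle _ (iter p T (z (k + j)%N)) _) _.
rewrite addrC; apply: lerD; last exact: ltW xy.
by apply: le_trans (zjk k j p pL) _; rewrite gerBl mulr_ge0// invr_ge0 exprn_ge0.
Qed.

Lemma interval_of_growing (L : nat -> nat) K n : (forall k, (L k < L k.+1)%N) ->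
  (L K <= n)%N -> exists2 k, (K <= k)%N & (L k <= n <= L k.+1)%N.
Proof.
move=> Linc; elim: n => [|n IH].
  by rewrite leqn0 => /eqP L0; exists K; rewrite // L0.
rewrite leq_eqVlt => /predU1P[LK|/IH[k Kk /andP[Lk kn]]].
  by exists K => //; rewrite LK leqnn -LK ltnW.
have [nk|kn'] := ltnP n (L k.+1).
  by exists k => //; rewrite nk (leq_trans Lk).
exists k.+1; first exact: leqW.
have -> : n = L k.+1 by apply/eqP; rewrite eqn_leq kn kn'.
by rewrite leqnSn Linc.
Qed.

(** Stage [k] prolongs the orbit of [z k] beyond time [L k], controlling the first [k] functions
    with tolerance [1 / (k + 1)]. The lengths grow so fast that the additive constant and the
    earlier past become negligible. *)
Lemma generic_point0 (mu : probability (borelX X) R) (h : nat -> X -> R) :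
  Tinvariant T mu -> (forall i, continuous (h i)) ->
  (forall i, rint mu (h i) = 0) ->
  exists x, forall i (t : R), 0 < t -> exists N, forall n, (N <= n)%N ->
    `|birkhoff T (h i) n x| <= n%:R * t.
Proof.
move=> inv ch h0.
have e0 k : 0 < k.+1%:R^-1 :> R by rewrite invr_gt0.
have d0 k : 0 < (2 ^+ k)^-1 :> R by rewrite invr_gt0 exprn_gt0.
have /choice[C CP] k := specification_extension compactX contT specT inv
  (fun i (_ : (i < k)%N) => ch i) (fun i (_ : (i < k)%N) => h0 i) (e0 k) (d0 k).
pose c k := (Num.truncn (C k)).+1.
have Cc k : C k <= (c k)%:R by apply: ltW; exact: truncnS_gt.
(* The two summands ensure that [L k] is at most [L k.+1 / (k + 1)], and that [C k] is at most
   [L k / (k + 1)]. *)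
pose L := fix L k := if k is k'.+1 then (k * L k' + k.+1 * c k)%N else c 0%N.
have L0 k : (0 < L k)%N by case: k => [|k] //=; rewrite addn_gt0 muln_gt0 orbT.
have Linc k : (L k < L k.+1)%N.
  by rewrite /=; have := L0 k; move: (L k) (c k.+1) (isT : (0 < c k.+1)%N) => a b; nia.
have Lmono k j : (k <= j)%N -> (L k <= L j)%N.
  move=> /subnKC <-; elim: (j - k)%N => [|i IH]; first by rewrite addn0.
  by rewrite addnS (leq_trans IH)// ltnW.
have LC k : (k.+1 * c k <= L k)%N by case: k => [|k] /=; rewrite ?mul1n// leq_addl.
have CL k : C k <= (L k)%:R * k.+1%:R^-1.
  rewrite ler_pdivlMr// mulrC; apply: le_trans (_ : k.+1%:R * (c k)%:R <= _).
    by rewrite ler_wpM2l.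
  by rewrite -natrM ler_nat.
have LL k : (k.+1 * L k <= L k.+1)%N by rewrite /= leq_addr.
have /choice[ext extP] (kz : nat * X) := CP kz.1 kz.2 (L kz.1) (L kz.1.+1) (L0 kz.1).
pose z := fix z k := if k is k'.+1 then ext (k', z k') else point.
have [|x xz] := @cluster_point_shadow z L Lmono.
  by move=> k p pL; exact: (extP (k, z k)).1.
exists x => i t t0.
have t8 : 0 < t / 8 by rewrite divr_gt0.
have [B hB] := continuous_bdd compactX (ch i).
have B0 : 0 <= B by exact: le_trans (hB x).
have [d d00 hd] := uniform_continuity compactX (ch i) t8.
have [K1 K1P] : exists K1 : nat, forall k, (K1 <= k)%N -> (2 ^+ k)^-1 < d.
  have := @cvg_expr R 2^-1; rewrite gtr0_norm ?invr_gt0// invf_lt1// ltr1n => /(_ isT).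
  move=> /cvgrPdist_lt/(_ _ d00)[K1 _ KP]; exists K1 => k /KP /=.
  by rewrite sub0r normrN exprVn gtr0_norm.
(* The factor [B + 1] bounds at once the stage tolerance [1 / (k + 1)] and the share [B / (k + 1)]
   of the earlier past. *)
pose K2 := (Num.truncn ((B + 1) / (t / 8))).+1.
have K2P k : (K2 <= k)%N -> (B + 1) * k.+1%:R^-1 <= t / 8.
  move=> Kk; rewrite ler_pdivrMr// mulrC -ler_pdivrMr//; apply: ltW.
  by apply: lt_le_trans (truncnS_gt _) _; rewrite ler_nat leqW.
(* Taking [k] at least [i.+1] puts [h i] among the functions controlled at stage [k]. *)
pose K := maxn (maxn K1 K2) i.+1.
have stage k n : (K <= k)%N -> (L k <= n <= L k.+1)%N ->
    `|birkhoff T (h i) n x| <= `|birkhoff T (h i) (L k) x| + n%:R * (t / 4).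
  rewrite !geq_max -andbA => /and3P[Kk1 Kk2 ik] /andP[Ln nL].
  rewrite -{1}(subnKC Ln) birkhoff_add; apply: le_trans (ler_normD _ _) _.
  rewrite lerD2l; set r := (n - L k)%N.
  have h1 : `|birkhoff T (h i) r (iter (L k) T (z k.+1))| <= r%:R * k.+1%:R^-1 + C k.
    apply: ((extP (k, z k)).2 i r ik).
    by apply: leq_trans nL; exact: leq_subr.
  have h2 : `|birkhoff T (h i) r (iter (L k) T x) - birkhoff T (h i) r (iter (L k) T (z k.+1))|
      <= r%:R * (t / 8).
    apply: birkhoff_shadow => p pr; apply: hd; rewrite -!iterD.
    apply: le_lt_trans (xz k.+1 (p + L k)%N _) _; first by rewrite /r in pr; lia.
    by rewrite exprS invfM mulrA divff// mul1r K1P.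
  rewrite -[X in `|X|](subrK (birkhoff T (h i) r (iter (L k) T (z k.+1)))).
  apply: le_trans (ler_normD _ _) _; apply: le_trans (lerD h2 h1) _.
  have h3 : k.+1%:R^-1 <= t / 8.
    by apply: le_trans (K2P k Kk2); rewrite ler_peMl// lerDr.
  have h4 := CL k.
  have h5 : (L k)%:R * k.+1%:R^-1 <= (L k)%:R * (t / 8) by rewrite ler_wpM2l.
  have h6 : r%:R * k.+1%:R^-1 <= r%:R * (t / 8) by rewrite ler_wpM2l.
  have nE : n%:R = (L k)%:R + r%:R :> R by rewrite -natrD subnKC.
  have h8 : 0 <= (L k)%:R * (t / 8) by rewrite mulr_ge0// ltW.
  rewrite (_ : n%:R * (t / 4) = 2 * ((L k)%:R * (t / 8)) + 2 * (r%:R * (t / 8))).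
    move: h4 h5 h6 h8.
    move: (C k) ((L k)%:R * k.+1%:R^-1) ((L k)%:R * (t / 8)) => c1 c2 c3.
    move: (r%:R * k.+1%:R^-1) (r%:R * (t / 8)) => c4 c5.
    lra.
  by rewrite nE; field.
(* At the end of a stage even the trivial bound [L k * B] on the past is small relative to
   [L k.+1]. *)
have stage_end k : (K <= k)%N -> `|birkhoff T (h i) (L k.+1) x| <= (L k.+1)%:R * (t / 2).
  move=> Kk; apply: le_trans (stage k _ Kk _) _; first by rewrite ltnW//=.
  have Kk2 : (K2 <= k)%N by move: Kk; rewrite !geq_max => /andP[/andP[]].
  have h1 : `|birkhoff T (h i) (L k) x| <= (L k)%:R * B by exact: birkhoff_bound.
  have h2 : (L k)%:R <= (L k.+1)%:R * k.+1%:R^-1 :> R.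
    by rewrite ler_pdivlMr// mulrC -natrM ler_nat.
  have h3 : (L k)%:R * B <= (L k.+1)%:R * (t / 8).
    apply: le_trans (_ : (L k.+1)%:R * k.+1%:R^-1 * B <= _); first by rewrite ler_wpM2r.
    rewrite -mulrA ler_wpM2l// mulrC; apply: le_trans (K2P k Kk2).
    by rewrite ler_wpM2r ?invr_ge0// lerDl.
  have h4 : 0 <= (L k.+1)%:R * (t / 8) by rewrite mulr_ge0// ltW.
  by apply: le_trans (lerD (le_trans h1 h3) (lexx _)) _; move: h4; lra.
(* Starting one stage after [K] makes [stage_end] available for the past of the stage containing
   [n]; the costs [t / 2] and [t / 4] add up to less than [t]. *)
exists (L K.+1) => n /(interval_of_growing Linc)[[//|k]]; rewrite ltnS => Kk kn.
apply: le_trans (stage k.+1 n (leqW Kk) kn) _.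
apply: le_trans (lerD (stage_end k Kk) (lexx _)) _.
have h1 : (L k.+1)%:R * (t / 2) <= n%:R * (t / 2).
  by rewrite ler_wpM2r ?divr_ge0 ?(ltW t0)// ler_nat; case/andP: kn.
have h2 : 0 <= n%:R * (t / 4) by rewrite mulr_ge0// divr_ge0// ltW.
by apply: le_trans (lerD h1 (lexx _)) _; move: h2; lra.
Qed.

Lemma generic_point (mu : probability (borelX X) R) (h : nat -> X -> R) :
  Tinvariant T mu -> (forall i, continuous (h i)) ->
  exists x, forall i (t : R), 0 < t -> exists N, forall n, (N <= n)%N ->
    `|birkhoff T (h i) n x - n%:R * rint mu (h i)| <= n%:R * t.
Proof.
move=> inv ch.
have cg i : continuous (fun x => h i x + - rint mu (h i)).
  by move=> x; apply: cvgD; [exact: ch|exact: cvg_cst].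
have g0 i : rint mu (fun x => h i x + - rint mu (h i)) = 0.
  by rewrite rintD ?rint_cst ?subrr//; [exact: bmeas_continuous|exact: bmeas_cst].
have [x xP] := generic_point0 inv cg g0.
exists x => i t /(xP i)[N NP]; exists N => n /NP.
rewrite (_ : birkhoff _ _ _ _ = birkhoff T (h i) n x - n%:R * rint mu (h i))//.
by rewrite birkhoffD /birkhoff sumr_const card_ord [in RHS]mulr_natl mulNrn.
Qed.

(** Each potential [q] has continuous approximants with tolerance [1 / (j + 1)]. Coding the pairs
    [(q, j)] by integers makes one point generic for all of them, with the zero function at integers
    that code no pair. *)
Lemma AAP_generic_point (mu : probability (borelX X) R) (fs : nat -> nat -> X -> R) :
  Tinvariant T mu -> (forall q, AAP T (fs q)) ->
  exists x, forall q, (fun n => fs q n x / n%:R) @ \oo --> pstar (fs q) mu.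
Proof.
move=> inv fsT.
have e0 j : 0 < j.+1%:R^-1 :> R by rewrite invr_gt0.
have /choice[h hP] (qj : nat * nat) :=
  AAP_pstar_approx compactX contT (fsT qj.1) inv (e0 qj.2).
pose g i := if unpickle i is Some qj then h qj else cst 0.
have cg i : continuous (g i).
  rewrite /g; case: unpickle => [qj|]; last exact: cst_continuous.
  by have [] := hP qj.
have [x xP] := generic_point inv cg.
exists x => q; apply/cvgrPdist_le => e epos.
have e3 : 0 < e / 3 by rewrite divr_gt0.
pose j := Num.truncn (e / 3)^-1.
have je : j.+1%:R^-1 <= e / 3.
  by rewrite -[leRHS]invrK lef_pV2 ?posrE ?invr_gt0// ltW// truncnS_gt.
have [_ h1 [N1 h2]] := hP (q, j).
have [N2 h3] := xP (pickle (q, j)) _ e3; rewrite /g pickleK in h3.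
near=> n.
have n0 : (0 < n)%N by near: n; exact: nbhs_infty_gt.
have n0' : 0 < n%:R :> R by rewrite ltr0n.
have {}h2 := h2 n _ x; have {}h3 := h3 n _.
have {}h2 : `|fs q n x - birkhoff T (h (q, j)) n x| <= n%:R * (e / 3).
  apply: le_trans (h2 _) _; first by near: n; exact: nbhs_infty_ge.
  by rewrite ler_wpM2l.
have {}h3 : `|birkhoff T (h (q, j)) n x - n%:R * rint mu (h (q, j))| <= n%:R * (e / 3).
  by apply: h3; near: n; exact: nbhs_infty_ge.
have {}h1 : `|n%:R * rint mu (h (q, j)) - n%:R * pstar (fs q) mu| <= n%:R * (e / 3).
  by rewrite -mulrBr normrM gtr0_norm// ler_pM2l// distrC (le_trans h1).
have -> : pstar (fs q) mu - fs q n x / n%:R =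
    n%:R^-1 * (n%:R * pstar (fs q) mu - fs q n x) by field; rewrite gt_eqF.
rewrite normrM gtr0_norm ?invr_gt0// ler_pdivrMl// distrC.
rewrite (_ : fs q n x - n%:R * pstar (fs q) mu =
  (fs q n x - birkhoff T (h (q, j)) n x)
  + (birkhoff T (h (q, j)) n x - n%:R * rint mu (h (q, j)))
  + (n%:R * rint mu (h (q, j)) - n%:R * pstar (fs q) mu)); last by ring.
apply: le_trans (ler_normD _ _) _.
apply: le_trans (lerD (ler_normD _ _) (lexx _)) _.
apply: le_trans (lerD (lerD h2 h3) h1) _.
by rewrite le_eqVlt; apply/orP; left; apply/eqP; field.
Unshelve. all: by end_near.
Qed.

End generic_points.

(** * Comparison of the three suprema *)

Lemma ereal_lt_between (R : realType) (x y : \bar R) : (x < y)%E ->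
  exists2 c : R, (x < c%:E)%E & (c%:E < y)%E.
Proof.
case: x y => [r| |] [s| |]// xy.
- by exists ((r + s) / 2); move: xy; rewrite !lte_fin => rs; rewrite midf_lt.
- by exists (r + 1); rewrite ?ltry// lte_fin ltrDl.
- by exists (s - 1); rewrite ?ltNyr// lte_fin ltrBlDr ltrDl.
- by exists 0; rewrite ?ltNyr ?ltry.
Qed.

Unset Implicit Arguments.

Theorem theoremE (R : realType) (X : pointedMetricType R) (T : X -> X)
  (f phi g psi : nat -> X -> R) (sigma : R) (alpha : R) :
  compact [set: X] -> continuous T -> specification T ->
  AAP T f -> AAP T phi -> AAP T g -> AAP T psi ->
  0 < sigma ->
  (forall n x, (0 < n)%N -> sigma <= g n x / n%:R) ->
  (forall n x, (0 < n)%N -> sigma <= psi n x / n%:R) ->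
  levelset phi psi alpha !=set0 ->
  ereal_sup [set limn_esup (fun n => (f n x / g n x)%:E) | x in levelset phi psi alpha]
    = ereal_sup [set (pstar f mu / pstar g mu)%:E | mu in
                   [set mu : probability (borelX X) R | Tinvariant T mu /\
                      pstar phi mu / pstar psi mu = alpha]]
  /\
  ereal_sup [set (pstar f mu / pstar g mu)%:E | mu in
                   [set mu : probability (borelX X) R | Tinvariant T mu /\
                      pstar phi mu / pstar psi mu = alpha]]
    = ereal_sup [set (pstar f mu / pstar g mu)%:E | mu in
                   \bigcup_(x in levelset phi psi alpha) Vlim T x].
Proof.
move=> cX cT sT fT phiT gT psiT s0 gs psis _.
set A := ereal_sup [set limn_esup _ | x in _].
set B := ereal_sup [set _ | mu in [set mu | _ /\ _]].
set C := ereal_sup [set _ | mu in \bigcup_(x in _) _].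
have AC : (A <= C)%E.
  apply: ge_ereal_sup => _ [x xE <-]; rewrite leNgt; apply/negP => Clt.
  (* The limit superior is an extended real, so a real level strictly below it is used to select the
     times. *)
  have [c Cc cL] : exists2 c : R, (C < c%:E)%E &
      (c%:E < limn_esup (fun n => (f n x / g n x)%:E))%E.
    exact: ereal_lt_between.
  have [mu muV cmu] := limsup_ratio_attained cX cT fT gT s0 gs cL.
  move: Cc; rewrite ltNge => /negP; apply.
  apply: (@le_trans _ _ (pstar f mu / pstar g mu)%:E); first by rewrite lee_fin.
  by apply: ereal_sup_ubound; exists mu => //; exists x.
have CB : (C <= B)%E.
  apply: ge_ereal_sup => _ [mu [x xE muV] <-]; apply: ereal_sup_ubound.
  exists mu => //; split; last exact: Vlim_ratio muV phiT psiT s0 psis xE.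
  exact: cluster_along_invariant (Vlim_cluster_along muV).
have BA : (B <= A)%E.
  apply: ge_ereal_sup => _ [mu [inv muE] <-].
  (* The default [f] keeps every term of the sequence asymptotically additive. A single [x] then
     serves both ratios: that of [phi] and [psi] puts it in the level set, that of [f] and [g] gives
     the value. *)
  pose fs q := nth f [:: f; phi; g; psi] q.
  have fsT q : AAP T (fs q) by case: q => [|[|[|[|q]]]] //; rewrite /fs nth_default.
  have [x xP] := AAP_generic_point cX cT sT inv fsT.
  have ratio a b : (forall n y, (0 < n)%N -> sigma <= b n y / n%:R) -> AAP T b ->
      (fun n => a n x / n%:R) @ \oo --> pstar a mu ->
      (fun n => b n x / n%:R) @ \oo --> pstar b mu ->
      (fun n => a n x / b n x) @ \oo --> pstar a mu / pstar b mu.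
    move=> bs bT ca cb.
    have pb : pstar b mu != 0.
      by rewrite gt_eqF// (lt_le_trans s0)//; exact: pstar_ge bs.
    apply: cvg_trans (cvgM ca (cvgV pb cb)).
    apply: near_eq_cvg; exists 1%N => // n /= n0.
    have n0' : n%:R != 0 :> R by rewrite pnatr_eq0 -lt0n.
    by rewrite /= invfM invrK mulrACA mulVf// mulr1.
  have cfg := ratio f g gs gT (xP 0%N) (xP 2%N).
  have -> : (pstar f mu / pstar g mu)%:E = limn_esup (fun n => (f n x / g n x)%:E).
    by symmetry; apply: (cvg_limn_einf_sup _).2; apply: cvg_EFin; [exact: nearW|exact: cfg].
  apply: ereal_sup_ubound; exists x => //.
  by rewrite /levelset /= -muE; exact: (ratio phi psi psis psiT (xP 1%N) (xP 3%N)).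
split; apply/eqP; rewrite eq_le.
  by rewrite BA (le_trans AC CB).
by rewrite CB (le_trans BA AC).
Qed.
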